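(* Let $F$ be a field of characteristic not equal to $2$, let $V$ be a $2n$-dimensional vector space over $F$, let $\Omega: V\times V\to F$ be a non-degenerate symplectic form, and let $k\in\{1,\dots,n-1\}$. If $n\neq 2k$ and $\max(k,n-k)\geq 5$, then any commutativity preserving bijective transformation $f$ of ${\mathfrak I}_{k}(\Omega)$ can be extended to an automorphism of the group ${\rm Sp}(\Omega)$; that is, there is a group automorphism $g$ of ${\rm Sp}(\Omega)$ with $g(u)=f(u)$ for all $u\in{\mathfrak I}_k(\Omega)$.
   Context: ${\rm Sp}(\Omega)$ is the group of linear automorphisms of $V$ preserving $\Omega$. For an involution $u\in{\rm GL}(V)$ put $S_{+}(u)=\{x: u(x)=x\}$ and $S_{-}(u)=\{x: u(x)=-x\}$, so $V=S_{+}(u)+S_{-}(u)$. ${\mathfrak I}_{k}(\Omega)$ is the set of symplectic $(2k,2n-2k)$-involutions, i.e. of all involutions $u\in{\rm Sp}(\Omega)$ such that $\dim S_{+}(u)=2k$ and $\dim S_{-}(u)=2n-2k$. A bijection $f$ of ${\mathfrak I}_{k}(\Omega)$ to itself is commutativity preserving if for all $s,u\in{\mathfrak I}_{k}(\Omega)$: $su=us$ if and only if $f(s)f(u)=f(u)f(s)$. *)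

(* Defs.v *)
From HB Require Import structures.
From mathcomp Require Import all_boot all_order all_algebra.
From mathcomp Require Import boolp.

Set Implicit Arguments.
Unset Strict Implicit.
Unset Printing Implicit Defensive.

Import GRing.Theory.
Local Open Scope ring_scope.

Section SymplecticGroup.
Variables (F : fieldType) (V : vectType F) (Omega : {skew_symmetric V}).

(* On the finite dimensional space V, an endomorphism is a linear automorphism
   iff it is bijective. *)
Definition sp_pred : pred 'End(V) :=
  fun u => `[< bijective u /\ isometry Omega Omega u >].

(* The symplectic group, with composition (u * v)(x) = u (v x) as product. *)
Record Sp : predArgType := MkSp { Sp_val :> 'End(V); _ : sp_pred Sp_val }.

HB.instance Definition _ := [isSub for Sp_val].
HB.instance Definition _ := [Choice of Sp by <:].

Lemma SpP (u : Sp) : bijective u /\ isometry Omega Omega u.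
Proof. by case: u => u /= /asboolP. Qed.

Lemma sp_pred1 : sp_pred \1%VF.
Proof.
apply/asboolP; split; first by exists (\1%VF : 'End(V)) => x; rewrite !id_lfunE.
by move=> x y; rewrite !id_lfunE.
Qed.

Lemma sp_predM (u v : Sp) : sp_pred (u \o v)%VF.
Proof.
have [[bu iu] [bv iv]] := (SpP u, SpP v).
apply/asboolP; split; last by move=> x y; rewrite !comp_lfunE iu iv.
by apply: (eq_bij (bij_comp bu bv)) => x; rewrite comp_lfunE.
Qed.

Lemma Sp_lker0 (u : Sp) : lker u == 0%VS.
Proof. by apply/lker0P/bij_inj/(SpP u).1. Qed.

Lemma sp_predV (u : Sp) : sp_pred (u^-1)%VF.
Proof.
have ku := Sp_lker0 u.
apply/asboolP; split.
  by exists u; [apply: lker0_lfunVK | apply: lker0_lfunK].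
by move=> x y; rewrite -(SpP u).2 !lker0_lfunVK.
Qed.

Definition sp_one : Sp := MkSp sp_pred1.
Definition sp_mul (u v : Sp) : Sp := MkSp (sp_predM u v).
Definition sp_invg (u : Sp) : Sp := MkSp (sp_predV u).

Lemma sp_mulA : associative sp_mul.
Proof. by move=> u v w; apply: val_inj; rewrite /= comp_lfunA. Qed.
Lemma sp_mul1g : left_id sp_one sp_mul.
Proof. by move=> u; apply: val_inj; rewrite /= comp_lfun1l. Qed.
Lemma sp_mulg1 : right_id sp_one sp_mul.
Proof. by move=> u; apply: val_inj; rewrite /= comp_lfun1r. Qed.
Lemma sp_mulVg : left_inverse sp_one sp_invg sp_mul.
Proof.
by move=> u; apply: val_inj; rewrite /= lker0_compVf // Sp_lker0.
Qed.
Lemma sp_mulgV : right_inverse sp_one sp_invg sp_mul.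
Proof.
by move=> u; apply: val_inj; rewrite /= lker0_compfV // Sp_lker0.
Qed.

HB.instance Definition _ :=
  isGroup.Build Sp sp_mulA sp_mul1g sp_mulg1 sp_mulVg sp_mulgV.

End SymplecticGroup.

Section Involutions.
Variables (F : fieldType) (V : vectType F).

Definition Splus (u : 'End(V)) : {vspace V} := passmx.leigenspace u 1.
Definition Sminus (u : 'End(V)) : {vspace V} := passmx.leigenspace u (-1).

Lemma mem_Splus (u : 'End(V)) x : (x \in Splus u) = (u x == x).
Proof.
by rewrite memv_ker scale1r add_lfunE opp_lfunE id_lfunE subr_eq0.
Qed.

Lemma mem_Sminus (u : 'End(V)) x : (x \in Sminus u) = (u x == - x).
Proof.
by rewrite memv_ker scaleN1r opprK add_lfunE id_lfunE addr_eq0.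
Qed.

Variable Omega : {skew_symmetric V}.

Definition pq_involution (p q : nat) : pred (Sp Omega) :=
  fun u => [&& (u * u)%g == 1%g, \dim (Splus u) == p & \dim (Sminus u) == q].

(* The symplectic (2k, 2n - 2k)-involutions, as a subtype of the group. The
   condition u * u = 1 does not exclude 1 and -1 by itself, but for 0 < k < n
   the two dimensions do. *)
Definition symp_invol (n k : nat) : Type :=
  {u : Sp Omega | pq_involution (2 * k) (2 * n - 2 * k) u}.

Definition commutativity_preserving (n k : nat)
    (f : symp_invol n k -> symp_invol n k) : Prop :=
  forall s u : symp_invol n k,
    (val s * val u = val u * val s)%g <->
    (val (f s) * val (f u) = val (f u) * val (f s))%g.

End Involutions.

(* Main.v *)
(* An involution u is determined by the nondegenerate subspace S_+(u), and two
   involutions commute iff the orthogonal projections onto these subspaces do;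
   passing to orthogonal complements we may assume 2k < n.  A frame is an
   orthogonal decomposition of V into hyperbolic planes P_1, ..., P_n; the sums
   of k of its planes form a maximal commuting family.  A subfamily has a
   commutative centralizer iff it separates every two indices, so f induces on
   each frame a bijection of k-subsets preserving separating families, and this
   forces it to come from a bijection of the planes of two frames (this is where
   n <> 2k and n - k >= 5 enter).  The image of a plane does not depend on the
   frame, because frames containing it are joined by steps changing two planes.
   The resulting bijection of hyperbolic planes preserves orthogonality, hence
   incidence, hence induces an orthogonality preserving bijection of the points of
   the projective space.  As in the fundamental theorem of projective geometry the
   latter is given by a semilinear similitude s, and the required automorphism is
   conjugation by s. *)
Require Import Defs.
From HB Require Import structures.
From mathcomp Require Import all_boot all_order all_algebra.
From mathcomp Require Import boolp perm.
From mathcomp Require Import zify ring.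

Set Implicit Arguments.
Unset Strict Implicit.
Unset Printing Implicit Defensive.

Import GRing.Theory.

(** * Bijections of k-subsets preserving separating families *)

(** Commutation cannot tell [u] from [- u], and accordingly separation of indices cannot tell a
    k-subset from its complement; only the sizes [k] and [n - k] can, which is why [n = 2k] is
    excluded. Adjacency of pairs of indices has to be recovered from triples of pairs that no
    k-subset separates simultaneously; the bound 5 on [n - k] serves the case [k = 2], where this
    takes [n >= 7]. Two unseparated indices [i], [j] spoil the commutativity of a centralizer
    because [P i + P j] has other orthogonal decompositions into two hyperbolic planes, and the
    family does not see which one is used. Orthogonality of planes determines their sums: the
    perpendicular of [P + Q] is spanned by its hyperbolic planes once [V] has dimension at least 9.
    The semilinear map is built without coordinates, from a coherent choice of representatives of
    the image points. Finally [u = 2p - 1] with [p] the orthogonal projection onto S_+(u), so a map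
    that respects orthogonality and carries S_+(u) to S_+(f u) conjugates [u] into [f u]. *)

Section SubsetPermutations.
Variables n k : nat.

Lemma subset_between (T : finType) (A B : {set T}) (m : nat) :
  [disjoint A & B] -> #|A| <= m -> #|B| + m <= #|T| ->
  exists I : {set T}, [/\ #|I| = m, A \subset I & [disjoint I & B]].
Proof.
move=> dAB leA leB.
have cC : #|~: B :\: A| = #|T| - #|B| - #|A|.
  rewrite cardsD; have -> : ~: B :&: A = A.
    by apply/setIidPr; rewrite -disjoints_subset.
  by rewrite -(cardsC B); lia.
pose J := [set x in take (m - #|A|) (enum (~: B :\: A))].
have uJ : uniq (take (m - #|A|) (enum (~: B :\: A))) by rewrite take_uniq ?enum_uniq.
have cJ : #|J| = m - #|A|.
  rewrite cardsE (card_uniqP uJ) size_take -cardE cC.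
  by case: ltnP => h; lia.
have sJ x : x \in J -> (x \notin B) && (x \notin A).
  by rewrite inE => /mem_take; rewrite mem_enum !inE andbC.
exists (A :|: J); split; last 2 first.
- exact: subsetUl.
- rewrite disjoints_subset; apply/subsetP => x; rewrite !in_setU in_setC.
  case/orP => [xA|/sJ/andP[]//].
  by move: dAB; rewrite disjoints_subset => /subsetP/(_ x xA); rewrite inE.
rewrite cardsU cJ; suff -> : A :&: J = set0 by rewrite cards0; lia.
apply/setP => x; rewrite !inE; apply/negbTE/negP => /andP[xA xJ].
have := sJ x; rewrite inE xJ => /(_ isT)/andP[_]; by rewrite xA.
Qed.

Definition sep (I : {set 'I_n}) i j := (i \in I) != (j \in I).

Lemma sepC I i j : sep I i j = sep I j i.
Proof. by rewrite /sep eq_sym. Qed.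

Definition separating (X : pred {set 'I_n}) :=
  forall i j, i != j -> exists2 I, X I & sep I i j.

Hypotheses (k0 : 0 < k) (kn : 2 * k < n) (nk : 5 <= n - k).
Variable s : {set 'I_n} -> {set 'I_n}.
Hypothesis s_card : forall I : {set 'I_n}, #|I| = k -> #|s I| = k.
Hypothesis s_inj : forall I J : {set 'I_n}, #|I| = k -> #|J| = k -> s I = s J -> I = J.
Hypothesis s_sep : forall X : pred {set 'I_n}, (forall I : {set 'I_n}, X I -> #|I| = k) ->
  separating X <-> separating (fun J => [exists I : {set 'I_n}, X I && (J == s I)]).

Lemma ksubset_onto (J : {set 'I_n}) : #|J| = k -> exists2 I : {set 'I_n}, #|I| = k & s I = J.
Proof.
move=> cJ; pose A := [set I : {set 'I_n} | #|I| == k].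
have sA : s @: A \subset A.
  by apply/subsetP=> _ /imsetP[I + ->]; rewrite !inE => /eqP/s_card->.
have cA : #|s @: A| = #|A|.
  by apply: card_in_imset => I I'; rewrite !inE => /eqP cI /eqP; apply: s_inj.
have /eqP eA : s @: A == A by rewrite eqEcard sA cA /=.
have : J \in s @: A by rewrite eA inE cJ.
by case/imsetP => I; rewrite inE => /eqP cI ->; exists I.
Qed.

Lemma kset_between (A B : seq 'I_n) : ~~ has (mem B) A -> size A <= k -> size B + k <= n ->
  exists I : {set 'I_n}, [/\ #|I| = k, all (mem I) A & all (mem (~: I)) B].
Proof.
move=> /hasPn dAB sA sB.
have [||| I [cI AI dIB]] := @subset_between _ [set x in A] [set x in B] k.
- rewrite disjoints_subset; apply/subsetP => x; rewrite !inE; exact: dAB.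
- by rewrite cardsE; apply: leq_trans (card_size _) sA.
- rewrite cardsE card_ord; apply: leq_trans sB; rewrite leq_add2r; exact: card_size.
exists I; split=> //; apply/allP => x; first by move=> xA; apply: (subsetP AI); rewrite inE.
by move=> xB; rewrite !inE; apply/negP => xI; move: dIB;
  rewrite disjoints_subset => /subsetP/(_ x xI); rewrite !inE xB.
Qed.

(** If [c] avoids [i] and [j], a k-subset containing [c] but none of [d], [i], [j] separates [c]
    from [d] without separating [i] from [j]; so [a] and [b] both lie in the pair [i], [j]. *)
Lemma sep_incl i j a b : i != j -> a != b ->
  (forall I : {set 'I_n}, #|I| = k -> ~~ sep I i j -> ~~ sep I a b) ->
  (a = i /\ b = j) \/ (a = j /\ b = i).
Proof.
move=> ij ab H.
have key c d : c != d -> (forall I : {set 'I_n}, #|I| = k -> ~~ sep I i j -> ~~ sep I c d) ->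
    (c == i) || (c == j).
  move=> cd Hc; apply/negPn/negP; rewrite negb_or => /andP[ci cj].
  have [||| I [cI sI nI]] := @kset_between [:: c] [:: d; i; j]; rewrite /= ?inE ?orbF //.
  - by rewrite !negb_or cd ci cj.
  - lia.
  have := Hc I cI; move: sI nI; rewrite /sep /= !inE.
  by move=> /andP[-> _] /and4P[/negbTE-> /negbTE-> /negbTE->] _ /(_ isT).
have ba : b != a by rewrite eq_sym.
have H' (I : {set 'I_n}) : #|I| = k -> ~~ sep I i j -> ~~ sep I b a.
  by move=> cI h; rewrite sepC H.
have := key _ _ ba H'; have := key _ _ ab H; move: ab.
by move=> ab /orP[]/eqP e1 /orP[]/eqP e2; subst; rewrite ?eqxx // in ab; auto.
Qed.

(** A relation between unordered pairs: either pair may be reversed. Which end goes to which is only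
    decided by [pair_image_star]. *)
Definition pair_image i j a b :=
  [/\ i != j, a != b & forall I : {set 'I_n}, #|I| = k -> sep (s I) a b = sep I i j].

Lemma pair_imageCl i j a b : pair_image i j a b -> pair_image j i a b.
Proof. by case=> ij ab H; split=> // [|I cI]; rewrite 1?eq_sym // [RHS]sepC H. Qed.
Lemma pair_imageCr i j a b : pair_image i j a b -> pair_image i j b a.
Proof. by case=> ij ab H; split=> // [|I cI]; rewrite 1?eq_sym // sepC H. Qed.

Lemma not_separating X : ~ separating X ->
  exists i j, i != j /\ forall I, X I -> ~~ sep I i j.
Proof.
move=> nX; apply: contrapT => H; apply: nX => i j ij.
apply: contrapT => H'; apply: H; exists i, j; split=> // I XI.
by apply/negP => sI; apply: H'; exists I.
Qed.

(** The k-subsets that do not separate [i] and [j] form a nonseparating family, hence so do their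
    images; [a], [b] is a pair that all these images leave unseparated. *)
Lemma pair_image_fwd0 i j : i != j -> exists a b, a != b /\
  forall I : {set 'I_n}, #|I| = k -> ~~ sep I i j -> ~~ sep (s I) a b.
Proof.
move=> ij; pose X := fun I : {set 'I_n} => (#|I| == k) && ~~ sep I i j.
have nX : ~ separating X.
  by move=> /(_ i j ij)[I /andP[_ /negP]].
have Xk I : X I -> #|I| = k by case/andP => /eqP.
have := contra_not (s_sep Xk).2 nX => /not_separating[a [b [ab H]]].
exists a, b; split=> // I cI sI; apply: H; apply/existsP; exists I.
by rewrite /X cI eqxx sI /=.
Qed.

Lemma pair_image_bwd0 a b : a != b -> exists i j, i != j /\
  forall I : {set 'I_n}, #|I| = k -> ~~ sep (s I) a b -> ~~ sep I i j.
Proof.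
move=> ab; pose X := fun I : {set 'I_n} => (#|I| == k) && ~~ sep (s I) a b.
have Xk I : X I -> #|I| = k by case/andP => /eqP.
have nX : ~ separating X.
  move=> /(s_sep Xk).1/(_ a b ab)[J /existsP[I /andP[/andP[_ +] /eqP->]]].
  by move/negP.
have [i [j [ij H]]] := not_separating nX; exists i, j; split=> // I cI sI.
by apply: H; rewrite /X cI eqxx.
Qed.

(** Going forward to [a], [b] and back to [i'], [j'] gives a pair that is unseparated whenever [i],
    [j] is; by [sep_incl] it is the same pair, so the implications close up to an equivalence. *)
Lemma pair_image_exists i j : i != j -> exists a b, pair_image i j a b.
Proof.
move=> ij; have [a [b [ab H]]] := pair_image_fwd0 ij.
have [i' [j' [ij' H']]] := pair_image_bwd0 ab.
exists a, b; split=> // I cI; apply/idP/idP => [|sI].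
  by apply: contraTT => /(H _ cI).
apply: contraTT sI => /(H' _ cI).
by case: (sep_incl ij ij' (fun I cI h => H' I cI (H I cI h))) => -[-> ->]; rewrite // sepC.
Qed.

Lemma pair_image_inj i j i' j' a b : pair_image i j a b -> pair_image i' j' a b ->
  (i' = i /\ j' = j) \/ (i' = j /\ j' = i).
Proof.
move=> [ij _ H] [ij' _ H']; apply: sep_incl => // I cI.
by rewrite -H // -H'.
Qed.

Lemma pair_image_fun i j a b c d : pair_image i j a b -> pair_image i j c d ->
  (c = a /\ d = b) \/ (c = b /\ d = a).
Proof.
move=> [ij ab H] [_ cd H']; apply: sep_incl => // J /ksubset_onto[I cI <-].
by rewrite H // H'.
Qed.

Lemma pair_image_onto a b : a != b -> exists i j, pair_image i j a b.
Proof.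
move=> ab; have [i [j [ij H]]] := pair_image_bwd0 ab; exists i, j.
have [a' [b' [ab' H']]] := pair_image_fwd0 ij.
have E : (a' = a /\ b' = b) \/ (a' = b /\ b' = a).
  by apply: sep_incl => // J /ksubset_onto[I cI <-] /(H _ cI)/(H' _ cI).
split=> // I cI; apply/idP/idP; apply: contraTT; last exact: H.
by move/(H' _ cI); case: E => -[-> ->]; rewrite // sepC.
Qed.

(** * Adjacency of pairs of indices *)

Definition unseparable (e1 e2 e3 : 'I_n * 'I_n) := forall I : {set 'I_n}, #|I| = k ->
  ~~ [&& sep I e1.1 e1.2, sep I e2.1 e2.2 & sep I e3.1 e3.2].

Lemma unseparable_image i1 j1 i2 j2 i3 j3 a1 b1 a2 b2 a3 b3 :
  pair_image i1 j1 a1 b1 -> pair_image i2 j2 a2 b2 -> pair_image i3 j3 a3 b3 ->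
  unseparable (i1, j1) (i2, j2) (i3, j3) <-> unseparable (a1, b1) (a2, b2) (a3, b3).
Proof.
move=> [_ _ h1] [_ _ h2] [_ _ h3]; split=> H I.
  by move=> /ksubset_onto[J cJ <-] /=; rewrite h1 // h2 // h3 //; apply: H.
move=> cI; rewrite /= -h1 // -h2 // -h3 //; apply: H; exact: s_card.
Qed.

(** Parity: the number of separated sides of a triangle is even. This makes [unseparable], which is
    transported to images, a substitute for adjacency. *)
Lemma unseparable_triangle i j l : unseparable (i, j) (i, l) (j, l).
Proof. by move=> I _; rewrite /sep /=; case: (i \in I); case: (j \in I); case: (l \in I). Qed.

(** For [c] outside [j], [l] and [d] other than [i], a k-subset containing [i] and [c] and avoiding
    [j], [l], [d] separates all three pairs. Used for both orientations of [a], [b], this leaves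
    only the third side of the triangle. *)
Lemma unseparable_adjacent i j l a b : 1 < k -> i != j -> i != l -> j != l -> a != b ->
  unseparable (i, j) (i, l) (a, b) -> (a = j /\ b = l) \/ (a = l /\ b = j).
Proof.
move=> k1 ij il jl ab B.
have key c d : c != d -> unseparable (i, j) (i, l) (c, d) -> [|| d == i, c == j | c == l].
  move=> cd Bc; apply/negPn/negP; rewrite !negb_or => /and3P[di cj cl].
  have [||| I [cI sI nI]] := @kset_between [:: i; c] [:: j; l; d]; rewrite /= ?inE ?orbF //.
  - by rewrite !negb_or ij il eq_sym di cj cl cd.
  - lia.
  have := Bc I cI; move: sI nI; rewrite /sep /= !inE.
  by move=> /and3P[-> -> _] /and4P[/negbTE-> /negbTE-> /negbTE->].
have Bc : unseparable (i, j) (i, l) (b, a) by move=> I cI; have := B I cI; rewrite /= (sepC _ a).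
have h1 := key _ _ ab B; have ba : b != a by rewrite eq_sym.
have h2 := key _ _ ba Bc.
move: h1 h2 ij il jl ab.
by case/or3P=> /eqP -> /or3P[]/eqP ->; rewrite ?eqxx //; auto.
Qed.

(** With [a] inside a set and [b] outside, one of the two ways to separate [i] from [j] stays free
    of conflict. *)
Lemma orient (a b i j : 'I_n) : a != b -> i != j ->
  (a != j) && (b != i) \/ (a != i) && (b != j).
Proof.
move=> ab ij; case: (eqVneq a j) => [e|aj]; first subst a.
  by right; rewrite eq_sym ij /= eq_sym ab.
case: (eqVneq b i) => [e|bi]; last by left.
by subst b; right; rewrite ab ij.
Qed.

(** Each of the disjoint pairs is oriented compatibly with [a] inside and [b] outside; then at most
    three members and three non-members are prescribed, and [k] is at least 3. *)
Lemma separable_disjoint i j l m a b : 2 < k -> i != j -> l != m -> a != b ->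
  i != l -> i != m -> j != l -> j != m -> ~ unseparable (i, j) (l, m) (a, b).
Proof.
move=> k2 + + ab.
have key i' j' l' m' : i' != j' -> l' != m' -> i' != m' -> j' != l' ->
   (a != j') && (b != i') -> (a != m') && (b != l') -> ~ unseparable (i', j') (l', m') (a, b).
  move=> ij lm im jl /andP[aj bi] /andP[am bl] B.
  have [||| I [cI sI nI]] := @kset_between [:: i'; l'; a] [:: j'; m'; b]; rewrite /= ?inE ?orbF //.
  - rewrite !negb_or ij im (eq_sym i') bi lm (eq_sym l' j') jl (eq_sym l') bl.
    by rewrite aj am ab.
  - lia.
  have := B I cI; move: sI nI; rewrite /sep /= !inE.
  by move=> /and4P[-> -> -> _] /and4P[/negbTE-> /negbTE-> /negbTE->].
move=> ij lm il im jl jm B.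
have Bl : unseparable (j, i) (l, m) (a, b) by move=> I cI; have := B I cI; rewrite /= (sepC _ i).
have Br : unseparable (i, j) (m, l) (a, b) by move=> I cI; have := B I cI; rewrite /= (sepC _ l).
have Blr : unseparable (j, i) (m, l) (a, b).
  by move=> I cI; have := B I cI; rewrite /= (sepC _ i) (sepC _ l).
have ji : j != i by rewrite eq_sym.
have ml : m != l by rewrite eq_sym.
case: (orient ab ij) => h1; case: (orient ab lm) => h2.
- by apply: (key i j l m).
- by apply: (key i j m l).
- by apply: (key j i l m).
- by apply: (key j i m l).
Qed.

(** Disjoint separated pairs would contribute three different elements to [I], which has only
    two. *)
Lemma unseparable_disjoint2 i j l m x y : k = 2 -> uniq [:: i; j; l; m; x; y] ->
  unseparable (i, j) (l, m) (x, y).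
Proof.
move=> k2 u I cI; apply/negP; rewrite /sep /= => H.
suff : 2 < #|I| by rewrite cI k2.
pose c (p q : 'I_n) := if p \in I then p else q.
have cP p q : (p \in I) != (q \in I) -> c p q \in I by rewrite /c; case: ifP => //= _;
  case: (q \in I).
have -> : 2 = size [:: c i j; c l m] by [].
have /and3P[h1 h2 h3] := H.
have sub : {subset [:: c i j; c l m; c x y] <= I}.
  by move=> z; rewrite !inE => /or3P[]/eqP->; apply: cP.
have uc : uniq [:: c i j; c l m; c x y].
  move: u; rewrite /= !inE !negb_or /c =>
    /and5P[/and5P[? ? ? ? ?] /and4P[? ? ? ?] /and3P[? ? ?] /andP[? ?] ?].
  by case: ifP => _; case: ifP => _; case: ifP => _; apply/and3P; split=> //; apply/andP; split.
by have := uniq_leq_size uc (fun z hz => etrans (mem_enum _ z) (sub z hz)); rewrite -cardE.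
Qed.

Lemma three_more (A : seq 'I_n) : size A + 3 <= n ->
  exists x y z, uniq [:: x; y; z] /\ forall w, w \in A -> w \notin [:: x; y; z].
Proof.
move=> h; have : 3 <= #|~: [set x in A]|.
  have cs : #|[set x in A]| <= size A by rewrite cardsE card_size.
  by move: (cardsC [set x in A]); rewrite card_ord; lia.
rewrite cardE; case E : (enum _) => [|x [|y [|z r]]] // _.
have u : uniq [:: x, y, z & r] by rewrite -E enum_uniq.
exists x, y, z; split.
  by have := take_uniq 3 u; rewrite /= take0.
move=> w wA; apply/negP => wx.
have : w \in [:: x, y, z & r].
  by move: wx; rewrite !inE => /or3P[]->; rewrite ?orbT.
by rewrite -E mem_enum !inE wA.
Qed.

(* Two distinct pairs share an element iff exactly one third pair makes the triple
   unseparable.  For disjoint pairs there is no such third pair if k > 2, while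
   for k = 2 any pair disjoint from both will do, and n >= 7 gives two of them. *)
Lemma pair_image_adjacent i j l a b c d : 1 < k -> i != j -> i != l -> j != l ->
  pair_image i j a b -> pair_image i l c d -> [|| a == c, a == d, b == c | b == d].
Proof.
move=> k1 ij il jl E1 E2; apply/negPn/negP; rewrite !negb_or => /and4P[ac ad bc bd].
have [e [f E3]] := pair_image_exists jl.
have [_ ab _] := E1; have [_ cd _] := E2; have [_ ef _] := E3.
have B := (unseparable_image E1 E2 E3).1 (unseparable_triangle i j l).
case: (ltnP 2 k) => [k2|k2].
  by apply: (separable_disjoint k2 ab cd ef ac ad bc bd).
have ek : k = 2 by lia.
(* Four points and three fresh ones: for [k = 2] the bound on [n - k] gives exactly the required
   [n >= 7]. *)
have [| x [y [z [u uA]]]] := @three_more [:: a; b; c; d]; first by rewrite /=; lia.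
(* Every pair of fresh points is unseparable with the two disjoint images, so its preimage is the
   side [j], [l] and the pair itself is [e], [f]. *)
have bad' x' y' : x' != y' -> {subset [:: x'; y'] <= [:: x; y; z]} ->
    (x' = e /\ y' = f) \/ (x' = f /\ y' = e).
  move=> xy' sub.
  have Bx : unseparable (a, b) (c, d) (x', y').
    apply: unseparable_disjoint2 => //=.
    have nm w v : w \in [:: a; b; c; d] -> v \in [:: x'; y'] -> w != v.
      by move=> wA /sub vA; apply: contraNneq (uA _ wA) => ->.
    by rewrite !inE !negb_or ab ac ad bc bd cd xy' !nm ?inE ?eqxx ?orbT.
  have [p [q Ep]] := pair_image_onto xy'.
  have /unseparable_adjacent -/(_ k1 ij il jl) := (unseparable_image E1 E2 Ep).2 Bx.
  have [pq _ _] := Ep.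
  by case/(_ pq) => -[? ?]; subst p q; apply: (pair_image_fun E3) => //; apply: pair_imageCl.
move: u; rewrite /= !inE !negb_or => /and3P[/andP[xy xz] yz _].
have := bad' x y xy; have := bad' x z xz.
case=> [w||]; rewrite ?inE; first by case/orP => ->; rewrite ?orbT.
- case=> ? ?; subst x z; case=> [w|[_ ?]|[? _]]; rewrite ?inE; first by case/orP => ->;
  rewrite ?orbT.
  + by subst y; rewrite eqxx in yz.
  + by subst f; rewrite eqxx in ef.
- case=> ? ?; subst x z; case=> [w|[? _]|[_ ?]]; rewrite ?inE; first by case/orP => ->;
  rewrite ?orbT.
  + by subst f; rewrite eqxx in ef.
  + by subst y; rewrite eqxx in yz.
Qed.

(** The image of the third side is unseparable with the other two images, and [unseparable_adjacent]
    leaves only [u], [v] for it. *)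
Lemma pair_image_triangle i j l t u v : 1 < k -> i != j -> i != l -> j != l ->
  pair_image i j t u -> pair_image i l t v -> u != v /\ pair_image j l u v.
Proof.
move=> k1 ij il jl E1 E2.
have uv : u != v.
  apply/eqP => e; subst v; case: (pair_image_inj E1 E2) => -[e1 e2].
    by rewrite e2 eqxx in jl.
  by rewrite e1 eqxx in ij.
split=> //; have [e [f E3]] := pair_image_exists jl.
have [_ tu _] := E1; have [_ tv _] := E2; have [_ ef _] := E3.
have /unseparable_adjacent := (unseparable_image E1 E2 E3).1 (unseparable_triangle i j l).
by case/(_ k1 tu tv uv ef) => -[? ?]; subst e f => //; apply: pair_imageCr.
Qed.

(** The images of two pairs at [i] share a point [t]. The image of a further pair at [i] meets both;
    if it missed [t] it would be [u], [v], which is the image of [j], [l], a pair that does not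
    contain [i]. *)
Lemma pair_image_star i : 1 < k -> exists t, forall j, i != j -> exists u, pair_image i j t u.
Proof.
move=> k1; have [|j [l [m0 [u ui]]]] := @three_more [:: i]; first by rewrite /=; lia.
have := ui i (mem_head _ _); move: u; rewrite /= !inE !negb_or.
move=> /and3P[/andP[jl _] _ _] /and3P[ij il _].
have [t [u [v [E1 E2]]]] : exists t u v, pair_image i j t u /\ pair_image i l t v.
  have [a [b E1]] := pair_image_exists ij; have [c [d E2]] := pair_image_exists il.
  have := pair_image_adjacent k1 ij il jl E1 E2.
  case/or4P => /eqP ?; subst.
  - by exists c, b, d.
  - by exists d, b, c; split=> //; apply: pair_imageCr.
  - by exists c, a, d; split=> //; apply: pair_imageCr.
  - by exists d, a, c; split=> //; apply: pair_imageCr.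
have [uv E3] := pair_image_triangle k1 ij il jl E1 E2.
exists t => m im.
case: (eqVneq m j) => [->|mj]; first by exists u.
case: (eqVneq m l) => [->|ml]; first by exists v.
have [a [b E4]] := pair_image_exists im.
have [_ ab _] := E4; have [_ tu _] := E1; have [_ tv _] := E2.
have jm : j != m by rewrite eq_sym.
have lm : l != m by rewrite eq_sym.
case: (eqVneq a t) => [?|at0]; first by subst a; exists b.
case: (eqVneq b t) => [?|bt]; first by subst b; exists a; apply: pair_imageCr.
have h1 := pair_image_adjacent k1 ij im jm E1 E4.
have h2 := pair_image_adjacent k1 il im lm E2 E4.
exfalso; have [e|e] : (a = u /\ b = v) \/ (a = v /\ b = u).
  move: h1 h2; rewrite !(eq_sym t) (negbTE at0) (negbTE bt) /=.
  by case/orP => /eqP e /orP[] /eqP e'; subst; rewrite ?eqxx // in uv; auto.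
- case: e => ? ?; subst a b; case: (pair_image_inj E3 E4) => -[e1 e2].
    by rewrite e1 eqxx in ij.
  by rewrite e1 eqxx in il.
- case: e => ? ?; subst a b; case: (pair_image_inj E3 (pair_imageCr E4)) => -[e1 e2].
    by rewrite e1 eqxx in ij.
  by rewrite e1 eqxx in il.
Qed.

(** The centres of the stars define [t], and [s I] separates [t i] from [t j] exactly when [I]
    separates [i] from [j]; so [s I] is [t @: I] or its complement. For [k = 1], [s] acts on
    singletons directly. *)
Lemma ksubset_map_induced : exists2 t : 'I_n -> 'I_n, injective t &
  forall I : {set 'I_n}, #|I| = k -> s I = t @: I.
Proof.
case: (ltnP 1 k) => [k1|k1]; last first.
  have ek : k = 1 by lia.
  have H i : exists j, s [set i] = [set j].
    by apply/cards1P; rewrite s_card ?cards1 ek.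
  have [t tP] := fin_all_exists H.
  exists t => [i j tij | I]; last first.
    by rewrite ek => /eqP/cards1P[i ->]; rewrite tP imset_set1.
  by apply/set1_inj/s_inj; rewrite ?cards1 ?ek // !tP tij.
have [t tP] := fin_all_exists (fun i => @pair_image_star i k1).
have tinj : injective t.
  move=> i j tij; apply/eqP/negPn/negP => ij.
  have [|m [? [? [_ um]]]] := @three_more [:: i; j]; first by rewrite /=; lia.
  have im : i != m by have := um i (mem_head _ _); rewrite !inE !negb_or => /and3P[].
  have jm : j != m.
    by have := um j; rewrite !inE eqxx orbT => /(_ isT); rewrite !negb_or => /and3P[].
  have [u E1] := tP i j ij; have [v E2] := tP i m im; have [w E3] := tP j m jm.
  have [uv E3'] := pair_image_triangle k1 ij im jm E1 E2.
  have [_ tu _] := E1; have [_ tv _] := E2.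
  by case: (pair_image_fun E3' E3) => -[e _]; [move: tu | move: tv]; rewrite tij e eqxx.
have tE i j : i != j -> pair_image i j (t i) (t j).
  move=> ij; have [u E1] := tP i j ij.
  have ji : j != i by rewrite eq_sym.
  have [v E2] := tP j i ji.
  case: (pair_image_fun E1 (pair_imageCl E2)) => -[e1 e2].
    by move: ij; rewrite (tinj _ _ e1) eqxx.
  by rewrite e1.
exists t => // I cI.
have tS i j : sep (s I) (t i) (t j) = sep I i j.
  case: (eqVneq i j) => [->|ij]; first by rewrite /sep !eqxx.
  by have [_ _] := tE i j ij; apply.
have [i iI] : exists i, i \in I by apply/set0Pn; rewrite -card_gt0 cI.
have imP x : x \in t @: I = [exists j, (t j == x) && (j \in I)].
  apply/imsetP/existsP => [[j jI ->]|[j /andP[/eqP <- jI]]]; first by exists j; rewrite eqxx.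
  by exists j.
have tsurj x : exists j, t j = x.
  by have [t' tK t'K] := injF_bij tinj; exists (t' x).
case: (boolP (t i \in s I)) => ti.
  apply/setP => x; have [j <-] := tsurj x; rewrite mem_imset //.
  by have := tS i j; rewrite /sep ti iI /= => /negb_inj; case: (_ \in _); case: (_ \in _).
(* The complement has size [n - k], which differs from [k] by [2 * k < n]. *)
have /(congr1 (fun A : {set 'I_n} => #|A|)) : s I = ~: (t @: I).
  apply/setP => x; have [j <-] := tsurj x; rewrite inE mem_imset //.
  by have := tS i j; rewrite /sep (negbTE ti) iI; case: (_ \in _); case: (_ \in _).
rewrite s_card // => e; have := cardsC (t @: I).
by rewrite -e card_imset // cI card_ord; lia.
Qed.

End SubsetPermutations.

Local Open Scope ring_scope.

(** * Subspaces of a symplectic space *)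

Section SymplecticGeometry.
Variables (F : fieldType) (V : vectType F) (Omega : {skew_symmetric V}).
Hypothesis om_nondeg : forall x, (forall y, Omega x y = 0) -> x = 0.
Hypothesis two_neq0 : 2%:R != 0 :> F.

Local Notation "''[' u , v ]" := (Omega u%R v%R) : ring_scope.
Local Notation perp := (orthov Omega).

Implicit Types (x y z : V) (U W P : {vspace V}).

Lemma omZl a u v : '[a *: u, v] = a * '[u, v].
Proof. by rewrite linearZl. Qed.
Lemma omZr a u v : '[u, a *: v] = a * '[u, v].
Proof. by rewrite linearZr. Qed.
Lemma omDl u v w : '[u + v, w] = '[u, w] + '[v, w].
Proof. exact: linearDl. Qed.
Lemma omDr u v w : '[u, v + w] = '[u, v] + '[u, w].
Proof. exact: linearDr. Qed.
Lemma omNl u v : '[- u, v] = - '[u, v].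
Proof. exact: linearNl. Qed.
Lemma omNr u v : '[u, - v] = - '[u, v].
Proof. exact: linearNr. Qed.
Lemma om0l u : '[0, u] = 0.
Proof. exact: linear0l. Qed.
Lemma om0r u : '[u, 0] = 0.
Proof. exact: linear0r. Qed.
Lemma om_sumr x I (r : seq I) (A : pred I) (E : I -> V) :
  '[x, \sum_(i <- r | A i) E i] = \sum_(i <- r | A i) '[x, E i].
Proof. exact: linear_sumr. Qed.
Lemma omC u v : '[u, v] = - '[v, u].
Proof. by rewrite hermC expr1 mulN1r. Qed.
Lemma omxx u : '[u, u] = 0.
Proof.
have /eqP : '[u, u] *+ 2 = 0 by rewrite mulr2n {1}omC addNr.
by rewrite -mulr_natr mulf_eq0 (negbTE two_neq0) orbF => /eqP.
Qed.
Lemma om_eq0C u v : ('[u, v] == 0) = ('[v, u] == 0).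
Proof. exact: herm_eq0C. Qed.

Definition omE := (omDl, omDr, omNl, omNr, omZl, omZr, om0l, om0r, omxx).

Lemma om_neq0 x : x != 0 -> exists y, '[x, y] != 0.
Proof.
move=> x0; apply: contrapT => H; move/eqP: x0; apply; apply: om_nondeg => y.
by apply/eqP/negPn/negP => h; apply: H; exists y.
Qed.

Lemma perpx U x y : x \in perp U -> y \in U -> '[x, y] = 0.
Proof. by move/mem_orthovP; apply. Qed.

Lemma perpxC U x y : x \in U -> y \in perp U -> '[x, y] = 0.
Proof. by move=> xU yU; apply/eqP; rewrite om_eq0C; apply/eqP/(perpx yU xU). Qed.

Lemma perpS U W : (U <= W)%VS -> (perp W <= perp U)%VS.
Proof.
move=> sUW; apply/subvP => x xW; apply/mem_orthovP => y yU.
by apply: (perpx xW); apply: (subvP sUW).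
Qed.

Lemma perpsum U W : perp (U + W) = (perp U :&: perp W)%VS.
Proof.
apply/vspaceP => x; rewrite memv_cap;
  apply/mem_orthovP/andP => [H|[xU xW] _ /memv_addP[u uU [w wW ->]]].
  split; apply/mem_orthovP => y yU; apply: H.
    by apply: (subvP (addvSl _ _)).
  by apply: (subvP (addvSr _ _)).
by rewrite omDr (perpx xU uU) (perpx xW wW) addr0.
Qed.

Lemma perp_line x y : (x \in perp <[y]>) = ('[x, y] == 0).
Proof. exact: mem_orthov1. Qed.

(* Adding a line <x> to X only adds one functional: subtracting multiples of x
   reduces membership in the double perpendicular of <x> + X to that of X. *)
Lemma perpK U : perp (perp U) = U.
Proof.
apply/eqP; rewrite eqEsubv; apply/andP; split; last first.
  by apply/subvP => x xU; apply/mem_orthovP => y; apply: perpxC.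
rewrite -(span_basis (vbasisP U)); elim: (tval (vbasis U)) => [|x X IH].
  rewrite span_nil orthov0; apply/subvP => x /mem_orthovP H.
  by rewrite memv0; apply/eqP/om_nondeg => y; apply: H; rewrite memvf.
rewrite span_cons; apply/subvP => z zX.
case: (boolP (x \in <<X>>%VS)) => [xX|nxX].
  move: zX; have /addv_idPr -> : (<[x]> <= <<X>>)%VS by [].
  exact: (subvP IH).
have /mem_orthovPn[w wX xw] : x \notin perp (perp <<X>>).
  by apply: contra nxX => /(subvP IH).
set c := '[z, w] / '[x, w].
have zc : z - c *: x \in perp (perp <<X>>).
  apply/mem_orthovP => v vX.
  have : v - ('[x, v] / '[x, w]) *: w \in perp (<[x]> + <<X>>).
    rewrite perpsum memv_cap perp_line.
    rewrite [X in X == 0]omC !omE divfK // subrr oppr0 eqxx /=.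
    by rewrite memvB ?memvZ.
  by move/(perpx zX); rewrite !omE => <-; rewrite /c; field.
by rewrite -(subrK (c *: x) z) addrC memv_add ?memvZ ?memv_line // (subvP IH).
Qed.

(** Each basis vector of [U] lowers the dimension of the perpendicular by at most one; [U] may be
    degenerate. *)
Lemma dim_perp_ge U : (\dim {:V} <= \dim (perp U) + \dim U)%N.
Proof.
rewrite -[X in (_ + X)%N](size_tuple (vbasis U)) -[X in perp X](span_basis (vbasisP U)).
elim: (tval (vbasis U)) => [|x X IH]; first by rewrite span_nil orthov0 addn0.
rewrite span_cons perpsum capvC /=; apply: leq_trans IH _.
rewrite addnS -addSn leq_add2r; apply: leq_trans (_ : _ <= (\dim (perp <<X>>)).-1.+1)%N _;
  first by case: (\dim _).
by rewrite ltnS; exact: leq_dim_orthov1.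
Qed.

(** * Planes and hyperbolic planes *)

Definition line2 x y := (<[x]> + <[y]>)%VS.

Lemma line2P x y z : reflect (exists a b, z = a *: x + b *: y) (z \in line2 x y).
Proof.
apply: (iffP memv_addP) => [[_ /vlineP[a ->] [_ /vlineP[b ->] ->]]|[a [b ->]]].
  by exists a, b.
by exists (a *: x); rewrite ?memvZ ?memv_line //; exists (b *: y); rewrite ?memvZ ?memv_line.
Qed.

Lemma line2l x y : x \in line2 x y.
Proof. exact: (subvP (addvSl _ _) _ (memv_line _)). Qed.
Lemma line2r x y : y \in line2 x y.
Proof. exact: (subvP (addvSr _ _) _ (memv_line _)). Qed.

Lemma line2S x y U : (line2 x y <= U)%VS = (x \in U) && (y \in U).
Proof. by rewrite subv_add. Qed.

Lemma dim_line2 x y : x \notin <[y]>%VS -> y != 0 -> \dim (line2 x y) = 2%N.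
Proof.
move=> xy y0; rewrite dimv_disjoint_sum ?dim_vline ?y0.
  by case: eqP => // e; rewrite e mem0v in xy.
apply/eqP; rewrite -subv0; apply/subvP => z; rewrite memv_cap memv0 => /andP[/vlineP[a ->]].
case: (eqVneq a 0) => [-> _|a0 h]; first by rewrite scale0r.
by move: xy; rewrite -[x]scale1r -(mulVf a0) -scalerA memvZ.
Qed.

Lemma perp_line2 x y z : (z \in perp (line2 x y)) = ('[z, x] == 0) && ('[z, y] == 0).
Proof. by rewrite perpsum memv_cap !perp_line. Qed.

(** On a plane an alternating form that does not vanish is nondegenerate, so this is the usual
    notion of a hyperbolic plane. *)
Definition hyp P := (\dim P == 2) && ~~ (P <= perp P)%VS.

Lemma nperpP U W : reflect (exists x y, [/\ x \in U, y \in W & '[x, y] != 0])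
  (~~ (U <= perp W)%VS).
Proof.
apply: (iffP (@subvPn _ _ U (perp W))) => [[x xU /mem_orthovPn[y yW xy]]|[x [y [xU yW xy]]]].
  by exists x, y.
by exists x => //; apply/mem_orthovPn; exists y.
Qed.

Lemma om_neq0_free x y : '[x, y] != 0 -> x \notin <[y]>%VS /\ y != 0.
Proof.
move=> xy; split; apply: contra xy; last by move/eqP->; rewrite omE.
by case/vlineP => a ->; rewrite !omE mulr0.
Qed.

Lemma hyp_line2 x y : '[x, y] != 0 -> hyp (line2 x y).
Proof.
move=> xy; have [xNy y0] := om_neq0_free xy; rewrite /hyp dim_line2 // eqxx /=.
by apply/nperpP; exists x, y; rewrite line2l line2r.
Qed.

Lemma hyp_eq P x y : hyp P -> x \in P -> y \in P -> '[x, y] != 0 -> P = line2 x y.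
Proof.
move=> /andP[/eqP dP _] xP yP xy; apply/eqP; rewrite eq_sym eqEdim line2S xP yP.
by have [xNy y0] := om_neq0_free xy; rewrite dP dim_line2.
Qed.

Lemma hyp_basis P : hyp P -> exists x y, '[x, y] = 1 /\ P = line2 x y.
Proof.
move=> hP; have [_ /nperpP[x [y [xP yP xy]]]] := andP hP.
exists x, ('[x, y]^-1 *: y); rewrite !omE mulVf //; split=> //.
by apply: hyp_eq; rewrite ?memvZ // !omE mulVf // oner_neq0.
Qed.

Lemma hyp_partner P x : hyp P -> x \in P -> x != 0 -> exists2 y, y \in P & '[x, y] = 1.
Proof.
move=> /hyp_basis[a [b [ab ->]]] /line2P[c [d ->]] n0.
case: (eqVneq c 0) => [c0|c0].
  have d0 : d != 0 by apply: contraNneq n0 => ->; rewrite c0 !scale0r addr0.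
  exists (- d^-1 *: a); first by rewrite memvZ ?line2l.
  by rewrite !omE c0 (omC b a) ab; field.
exists (c^-1 *: b); first by rewrite memvZ ?line2r.
by rewrite !omE ab; field.
Qed.

Lemma hyp_orth_line P x y : hyp P -> x \in P -> y \in P -> x != 0 ->
  '[x, y] = 0 -> y \in <[x]>%VS.
Proof.
move=> hP xP yP x0 xy; have [z zP xz] := hyp_partner hP xP x0.
move: yP; rewrite (hyp_eq hP xP zP) ?xz ?oner_neq0 // => /line2P[a [b e]].
move: xy; rewrite e !omE xz mulr0 mulr1 add0r => ->.
by rewrite scale0r addr0 memvZ ?memv_line.
Qed.

Lemma hyp_in U : ~~ (U <= perp U)%VS -> exists2 P, hyp P & (P <= U)%VS.
Proof.
move=> /nperpP[x [y [xU yU xy]]]; exists (line2 x y); first exact: hyp_line2.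
by rewrite line2S xU.
Qed.

(** * Nondegenerate subspaces and orthogonal projections *)

Definition nondeg U := (U + perp U == fullv)%VS.
(** Defined for every subspace, but meant as the orthogonal projection only for nondegenerate [U],
    where [U] and its perpendicular are complementary. *)
Definition pr U : 'End(V) := daddv_pi U (perp U).

Lemma nondeg_cap U : nondeg U -> (U :&: perp U = 0)%VS.
Proof.
move=> /eqP nU; apply/eqP; rewrite -subv0; apply/subvP => x.
rewrite memv_cap memv0 => /andP[xU xU']; apply/eqP/om_nondeg => y.
have /memv_addP[u uU [w wU ->]] : y \in (U + perp U)%VS by rewrite nU memvf.
by rewrite omDr (perpx xU' uU) (perpxC xU wU) addr0.
Qed.

Lemma pr_mem U x : pr U x \in U.
Proof. exact: memv_pi. Qed.

Lemma prB U x y : pr U (x - y) = pr U x - pr U y.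
Proof. exact: linearB. Qed.

Lemma prD U x y : pr U (x + y) = pr U x + pr U y.
Proof. exact: linearD. Qed.

Lemma pr0 U : pr U 0 = 0.
Proof. exact: linear0. Qed.

Lemma pr_sum U I (r : seq I) (A : pred I) (E : I -> V) :
  pr U (\sum_(i <- r | A i) E i) = \sum_(i <- r | A i) pr U (E i).
Proof. exact: linear_sum. Qed.

Lemma pr_perp U x : nondeg U -> x - pr U x \in perp U.
Proof.
move=> nU; have := daddv_pi_add (w := x) (nondeg_cap nU); rewrite (eqP nU) memvf.
by move=> /(_ isT) {1}<-; rewrite addrC addKr memv_pi.
Qed.

Lemma pr_uniq U x u : nondeg U -> u \in U -> x - u \in perp U -> pr U x = u.
Proof.
move=> nU uU xu; apply/eqP; rewrite -subr_eq0 -memv0 -(nondeg_cap nU) memv_cap.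
rewrite memvB ?pr_mem //=; have -> : pr U x - u = (x - u) - (x - pr U x).
  by rewrite opprB [RHS]addrC addrA subrK.
by rewrite memvB ?pr_perp.
Qed.

Lemma pr_id U x : nondeg U -> x \in U -> pr U x = x.
Proof. by move=> nU xU; apply: pr_uniq => //; rewrite subrr mem0v. Qed.

Lemma pr_0 U x : nondeg U -> x \in perp U -> pr U x = 0.
Proof. by move=> nU xU; apply: pr_uniq => //; rewrite ?mem0v ?subr0. Qed.

Lemma nondeg_perp U : nondeg U -> nondeg (perp U).
Proof. by rewrite /nondeg perpK addvC. Qed.

Lemma pr_perpE U x : nondeg U -> pr (perp U) x = x - pr U x.
Proof.
move=> nU; apply: pr_uniq (nondeg_perp nU) (pr_perp x nU) _.
by rewrite perpK opprB addrC subrK pr_mem.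
Qed.

Lemma nondegI U : (forall x, exists2 u, u \in U & x - u \in perp U) -> nondeg U.
Proof.
move=> H; rewrite /nondeg eqEsubv subvf /=; apply/subvP => x _.
by have [u uU xu] := H x; rewrite -(subrK u x) addrC memv_add.
Qed.

Lemma hyp_nondeg P : hyp P -> nondeg P.
Proof.
move=> /hyp_basis[x [y [xy ->]]]; apply: nondegI => z.
(* The component of [z] expanded in the symplectic basis [x], [y]. *)
exists ('[z, y] *: x - '[z, x] *: y); first by rewrite memvB ?memvZ ?line2l ?line2r.
rewrite perpsum memv_cap !perp_line !omE (omC y x).
by rewrite xy; apply/andP; split; apply/eqP; ring.
Qed.

Lemma dim_perp U : nondeg U -> (\dim U + \dim (perp U) = \dim {:V})%N.
Proof. by move=> nU; rewrite -(eqP nU) dimv_disjoint_sum // nondeg_cap. Qed.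

Definition comm U W := forall x, pr U (pr W x) = pr W (pr U x).

Lemma comm_perp U W : nondeg U -> nondeg W -> comm U W -> comm (perp U) (perp W).
Proof.
move=> nU nW c x; rewrite !(pr_perpE _ nU) !(pr_perpE _ nW) !prB c.
by rewrite !opprD !opprK !addrA; congr (_ + _); exact: addrAC.
Qed.

Lemma comm_mem U W x : nondeg W -> comm U W -> x \in W -> pr U x \in W.
Proof. by move=> nW c xW; rewrite -(pr_id nW xW) c pr_mem. Qed.

(** * Frames *)

(** [m] is left free so that orthogonal families that do not span [V] are covered; for
    [\dim {:V} = 2 * m] they do span ([sumI_full]). *)
Definition frame m (P : 'I_m -> {vspace V}) :=
  (forall i, hyp (P i)) /\ (forall i j, i != j -> (P i <= perp (P j))%VS).

Definition sumI m (P : 'I_m -> {vspace V}) (I : {set 'I_m}) := (\sum_(i in I) P i)%VS.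

Section Frames.
Variables (m : nat) (P : 'I_m -> {vspace V}).
Hypothesis fP : frame P.

Lemma frame_nondeg i : nondeg (P i).
Proof. exact/hyp_nondeg/fP.1. Qed.

Lemma frame_pr0 i j x : i != j -> x \in P i -> pr (P j) x = 0.
Proof.
by move=> ij xi; apply: (pr_0 (frame_nondeg j)); apply: (subvP (fP.2 _ _ ij)).
Qed.

Lemma frame_pr i j x : pr (P i) (pr (P j) x) = if i == j then pr (P i) x else 0.
Proof.
case: (eqVneq i j) => [->|ij]; first by rewrite pr_id ?pr_mem ?frame_nondeg.
by apply: (@frame_pr0 j); rewrite ?pr_mem // eq_sym.
Qed.

Lemma mem_sumI (I : {set 'I_m}) i : i \in I -> (P i <= sumI P I)%VS.
Proof. by move=> iI; apply: (sumv_sup i). Qed.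

Lemma perp_sumI (I : {set 'I_m}) x :
  (forall i, i \in I -> x \in perp (P i)) -> x \in perp (sumI P I).
Proof.
move=> H; apply/mem_orthovP => _ /memv_sumP[y yP ->].
rewrite om_sumr; apply: big1 => i iI; exact: (perpx (H i iI) (yP i iI)).
Qed.

Lemma sumI_pr_perp (I : {set 'I_m}) x : x - \sum_(i in I) pr (P i) x \in perp (sumI P I).
Proof.
apply: perp_sumI => i iI; rewrite (bigD1 i) //= opprD addrA memvB ?pr_perp ?frame_nondeg //.
apply: memv_suml => j /andP[_ ji].
by apply: (subvP (fP.2 _ _ ji)); rewrite pr_mem.
Qed.

Lemma sumI_nondeg (I : {set 'I_m}) : nondeg (sumI P I).
Proof.
apply: nondegI => x; exists (\sum_(i in I) pr (P i) x); last exact: sumI_pr_perp.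
by apply: memv_sumr => i _; rewrite pr_mem.
Qed.

Lemma pr_sumI (I : {set 'I_m}) x : pr (sumI P I) x = \sum_(i in I) pr (P i) x.
Proof.
apply: (pr_uniq (sumI_nondeg I)); last exact: sumI_pr_perp.
by apply: memv_sumr => i _; rewrite pr_mem.
Qed.

Lemma pr_pr_sumI (I : {set 'I_m}) i x :
  pr (P i) (pr (sumI P I) x) = if i \in I then pr (P i) x else 0.
Proof.
rewrite pr_sumI pr_sum; case: ifP => iI.
  rewrite (bigD1 i) //= frame_pr eqxx big1 ?addr0 // => j /andP[_ ji].
  by rewrite frame_pr eq_sym (negbTE ji).
by apply: big1 => j jI; rewrite frame_pr; case: eqP => // e; rewrite e jI in iI.
Qed.

Lemma pr_sumI_sumI (I J : {set 'I_m}) x : pr (sumI P I) (pr (sumI P J) x) = pr (sumI P (I :&: J)) x.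
Proof.
rewrite pr_sumI (eq_bigr _ (fun i _ => pr_pr_sumI J i x)) -big_mkcondr pr_sumI.
by apply: eq_bigl => i; rewrite inE.
Qed.

Lemma comm_sumI (I J : {set 'I_m}) : comm (sumI P I) (sumI P J).
Proof. by move=> x; rewrite !pr_sumI_sumI setIC. Qed.

Lemma dim_sumI (I : {set 'I_m}) : \dim (sumI P I) = (2 * #|I|)%N.
Proof.
have d : directv (\sum_(i in I) P i)%VS.
  apply/directv_sum_independent => us Hu H0 i iI.
  have := congr1 (pr (P i)) H0; rewrite pr0 pr_sum (bigD1 i) //=.
  rewrite pr_id ?frame_nondeg ?Hu // big1 ?addr0 // => j /andP[jI ji].
  by rewrite (frame_pr0 ji) ?Hu.
rewrite (directvP d) /= (eq_bigr (fun=> 2)); last by move=> i _; case: (andP (fP.1 i)) => /eqP.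
by rewrite sum_nat_const mulnC.
Qed.

Hypothesis hm : \dim {:V} = (2 * m)%N.

Lemma sumI_full : sumI P setT = fullv.
Proof. by apply/eqP; rewrite eqEdim subvf dim_sumI cardsT card_ord hm /=. Qed.

Lemma frame_sum x : x = \sum_i pr (P i) x.
Proof.
have e := pr_id (sumI_nondeg setT); rewrite sumI_full in e.
by rewrite -{1}(e x (memvf _)) -sumI_full pr_sumI; apply: eq_bigl => i; rewrite inE.
Qed.

Lemma sumIP (I : {set 'I_m}) x :
  reflect (forall i, i \notin I -> pr (P i) x = 0) (x \in sumI P I).
Proof.
apply: (iffP idP) => [xI i iI | H].
  by rewrite -(pr_id (sumI_nondeg I) xI) pr_pr_sumI (negbTE iI).
rewrite (frame_sum x) (bigID (fun i => i \in I)) /= [X in _ + X]big1 ?addr0 //.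
by apply: memv_sumr => i _; rewrite pr_mem.
Qed.

Lemma perp_sumIE (I : {set 'I_m}) : perp (sumI P I) = sumI P (~: I).
Proof.
apply/vspaceP => x; apply/idP/sumIP => [xI i | H].
  rewrite !inE negbK => iI; apply: (pr_0 (frame_nondeg i)).
  by apply: (subvP (perpS (mem_sumI iI))).
apply: perp_sumI => i iI.
have := pr_perp x (frame_nondeg i); rewrite H ?subr0 //.
by rewrite !inE negbK.
Qed.

Lemma sumI_memE (I : {set 'I_m}) i : (P i <= sumI P I)%VS = (i \in I).
Proof.
apply/idP/idP => [|iI]; last exact: mem_sumI.
have [x [y [xy eP]]] := hyp_basis (fP.1 i).
have xi : x \in P i by rewrite eP line2l.
move=> /subvP/(_ x xi)/sumIP h; apply/negPn/negP => /h.
rewrite pr_id ?frame_nondeg // => x0; move: xy.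
by rewrite x0 om0l => /esym/eqP; rewrite oner_eq0.
Qed.

Lemma sumI_inj : injective (sumI P).
Proof. by move=> I J e; apply/setP => i; rewrite -!sumI_memE e. Qed.

Lemma sumI_cap (I J : {set 'I_m}) : (sumI P I :&: sumI P J)%VS = sumI P (I :&: J).
Proof.
apply/vspaceP => x; rewrite memv_cap; apply/andP/sumIP => [[/sumIP hI /sumIP hJ] i|H].
  by rewrite inE negb_and => /orP[/hI|/hJ].
by split; apply/sumIP => i h; apply: H; rewrite inE negb_and h ?orbT.
Qed.

(** A vector of [W] has no component in a plane orthogonal to [W], so the planes inside [W] already
    span it. *)
Lemma compat_sumI W : nondeg W -> (forall i, (P i <= W)%VS \/ (P i <= perp W)%VS) ->
  W = sumI P [set i | (P i <= W)%VS].
Proof.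
move=> nW H; apply/eqP; rewrite eqEsubv; apply/andP; split; last first.
  by apply/subv_sumP => i; rewrite inE.
apply/subvP => x xW; apply/sumIP => i; rewrite inE => iW.
case: (H i) => [h|h]; first by rewrite h in iW.
apply: (pr_0 (frame_nondeg i)); apply: (subvP _ _ xW); by rewrite orthov_sym.
Qed.

End Frames.

(** * Orthogonal sequences of hyperbolic planes *)

Definition hseq (s : seq {vspace V}) := all hyp s && pairwise (fun P Q => P <= perp Q)%VS s.

(** Lists serve for concatenation and induction, indexed families for sums over index sets; this
    passes from the former to the latter. *)
Lemma hseq_frame s m : size s = m -> hseq s -> frame (fun i : 'I_m => nth 0%VS s i).
Proof.
move=> <- /andP[/(all_nthP 0%VS) hs /(pairwiseP 0%VS) os]; split=> [i|i j ij]; first exact: hs.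
move: ij; rewrite neq_ltn => /orP[h|h]; first by apply: os; rewrite ?inE.
by rewrite orthov_sym; apply: os; rewrite ?inE.
Qed.

Lemma sumI_nth s m : size s = m ->
  sumI (fun i : 'I_m => nth 0%VS s i) setT = (\sum_(P <- s) P)%VS.
Proof.
move=> <-; rewrite (big_nth 0%VS) big_mkord; apply: eq_bigl => i.
by rewrite inE.
Qed.

Lemma hseq_dim s : hseq s -> \dim (\sum_(P <- s) P)%VS = (2 * size s)%N.
Proof.
by move=> hs; rewrite -(@sumI_nth _ _ erefl) (dim_sumI (hseq_frame erefl hs)) cardsT card_ord.
Qed.

Lemma hseq_nondeg s : hseq s -> nondeg (\sum_(P <- s) P)%VS.
Proof.
by move=> hs; rewrite -(@sumI_nth _ _ erefl); apply: (sumI_nondeg (hseq_frame erefl hs)).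
Qed.

Lemma hseq_cat s t : hseq (s ++ t) =
  [&& hseq s, hseq t & (\sum_(P <- s) P <= perp (\sum_(P <- t) P))%VS].
Proof.
rewrite /hseq all_cat pairwise_cat -!andbA; congr (_ && _).
have -> : allrel (fun P Q => P <= perp Q)%VS s t = (\sum_(P <- s) P <= perp (\sum_(P <- t) P))%VS.
  elim: s => [|P s IH]; first by rewrite big_nil sub0v.
  rewrite allrel_consl big_cons subv_add IH; congr (_ && _).
  elim: t {IH} => [|Q t IH]; first by rewrite big_nil orthov0 subvf.
  by rewrite big_cons /= perpsum subv_cap IH.
by case: (all hyp t); case: (pairwise _ s); case: (pairwise _ t); rewrite ?andbF ?andbT.
Qed.

Lemma nondeg_capl U W : nondeg U -> nondeg W -> (forall x, x \in U -> pr W x \in U) ->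
  nondeg (U :&: W).
Proof.
move=> nU nW H; apply: nondegI => x; exists (pr W (pr U x)).
  by rewrite memv_cap H ?pr_mem.
have -> : x - pr W (pr U x) = (x - pr U x) + (pr U x - pr W (pr U x)).
  by rewrite addrA subrK.
apply: memvD.
  exact: (subvP (perpS (capvSl U W)) _ (pr_perp x nU)).
exact: (subvP (perpS (capvSr U W)) _ (pr_perp (pr U x) nW)).
Qed.

Lemma cap_decomp U W : nondeg W -> (forall x, x \in U -> pr W x \in U) ->
  (U :&: W + U :&: perp W)%VS = U.
Proof.
move=> nW H; apply/eqP; rewrite eqEsubv subv_add !capvSl /=; apply/subvP => x xU.
rewrite -(subrK (pr W x) x) addrC memv_add // memv_cap ?(H x xU) ?pr_mem //.
by rewrite (pr_perp x nW) memvB ?H.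
Qed.

(** Hyperbolic planes are split off one by one; when none is left the space is totally isotropic and
    nondegenerate, hence zero. *)
Lemma nondeg_hseq U : nondeg U -> exists s, hseq s /\ (\sum_(P <- s) P)%VS = U.
Proof.
have [k] := ubnP (\dim U); elim: k U => // k IH U dU nU.
case: (boolP (U <= perp U)%VS) => [h|/hyp_in[P hP PU]].
  exists [::]; split=> //; rewrite big_nil; apply/eqP.
  by rewrite eq_sym -subv0 -(nondeg_cap nU) subv_cap subvv h.
have nP := hyp_nondeg hP; have nP' := nondeg_perp nP.
have HU x : x \in U -> pr P x \in U by move=> _; apply: (subvP PU); apply: pr_mem.
have HU' x : x \in U -> pr (perp P) x \in U by move=> xU; rewrite pr_perpE // memvB ?HU.
have eU := cap_decomp nP HU; have /capv_idPr eP := PU; rewrite eP in eU.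
have [|s [hs es]] := IH (U :&: perp P)%VS _ (nondeg_capl nU nP' HU').
  apply: (@leq_trans (\dim U)); last by rewrite -ltnS.
  rewrite -[X in (_ < \dim X)%N]eU dimv_disjoint_sum.
    by have /andP[/eqP-> _] := hP; lia.
  by apply/eqP; rewrite -subv0 -(nondeg_cap nP) capvS ?capvSr.
exists (P :: s); split; last by rewrite big_cons es.
rewrite -cat1s hseq_cat hs big_seq1 es /hseq /= hP /= orthov_sym.
exact: capvSr.
Qed.

(** Simultaneous diagonalization: [U] splits into its parts in [W] and in the perpendicular of [W],
    and both are stable under the remaining projections because these commute with [pr W]. *)
Lemma comm_family_hseq (L : seq {vspace V}) U : nondeg U ->
  (forall W, W \in L -> nondeg W) ->
  (forall W W', W \in L -> W' \in L -> comm W W') ->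
  (forall W x, W \in L -> x \in U -> pr W x \in U) ->
  exists s, [/\ hseq s, (\sum_(P <- s) P)%VS = U &
    forall P W, P \in s -> W \in L -> (P <= W)%VS \/ (P <= perp W)%VS].
Proof.
elim: L U => [|W L IH] U nU nL cL iL.
  by have [s [hs es]] := nondeg_hseq nU; exists s; split.
have WL : W \in W :: L by rewrite mem_head.
have LL W' : W' \in L -> W' \in W :: L by move=> h; rewrite inE h orbT.
have nW := nL W WL; have nW' := nondeg_perp nW.
have iW x : x \in U -> pr W x \in U by move=> xU; apply: iL.
have iW' x : x \in U -> pr (perp W) x \in U by move=> xU; rewrite pr_perpE // memvB ?iW.
have [||||s1 [hs1 es1 Hs1]] := IH (U :&: W)%VS.
- exact: nondeg_capl.
- by move=> ? /LL; apply: nL.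
- by move=> W1 W2 /LL h1 /LL h2; apply: cL.
- move=> W' x /LL hW'; rewrite !memv_cap => /andP[xU xW].
  by rewrite (iL _ _ hW' xU) (comm_mem nW (cL _ _ hW' WL) xW).
have [||||s2 [hs2 es2 Hs2]] := IH (U :&: perp W)%VS.
- exact: nondeg_capl.
- by move=> ? /LL; apply: nL.
- by move=> W1 W2 /LL h1 /LL h2; apply: cL.
- move=> W' x /LL hW'; rewrite !memv_cap => /andP[xU xW].
  rewrite (iL _ _ hW' xU) /=; have := pr_id nW' xW; rewrite pr_perpE // => ex.
  by rewrite -ex prB -(cL W W') // -pr_perpE // pr_mem.
have e12 : (U :&: W + U :&: perp W)%VS = U by apply: cap_decomp.
have s1U Q : Q \in s1 -> (Q <= U :&: W)%VS.
  by rewrite -es1 => h; rewrite (big_rem _ h) addvSl.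
have s2U Q : Q \in s2 -> (Q <= U :&: perp W)%VS.
  by rewrite -es2 => h; rewrite (big_rem _ h) addvSl.
exists (s1 ++ s2); split.
- rewrite hseq_cat hs1 hs2 es1 es2 /=; apply: subv_trans (capvSr _ _) _.
  by rewrite orthov_sym capvSr.
- by rewrite big_cat /= es1 es2.
- move=> Q W'; rewrite mem_cat inE => /orP[h|h] /orP[/eqP->|h'].
  + by left; apply: subv_trans (s1U _ h) (capvSr _ _).
  + exact: Hs1.
  + by right; apply: subv_trans (s2U _ h) (capvSr _ _).
  + exact: Hs2.
Qed.

(** Otherwise [P] contains a nonzero vector of [W] and a nonzero vector of its perpendicular.
    Orthogonal vectors of a hyperbolic plane are proportional, but [W] and its perpendicular meet in
    zero. *)
Lemma hyp_stable P W : hyp P -> nondeg W -> (forall x, x \in P -> pr W x \in P) ->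
  (P <= W)%VS \/ (P <= perp W)%VS.
Proof.
move=> hP nW H; case: (boolP (P <= W)%VS) => [|/subvPn[y yP yW]]; first by left.
right; apply/subvP => x xP; have := pr_perp x nW.
case: (eqVneq (pr W x) 0) => [->|a0 _]; first by rewrite subr0.
exfalso; have b0 : y - pr W y != 0.
  by apply: contra yW; rewrite subr_eq0 => /eqP->; apply: pr_mem.
have : y - pr W y \in <[pr W x]>%VS.
  apply: (hyp_orth_line hP); rewrite ?H ?memvB ?H //.
  exact: (perpxC (pr_mem W x) (pr_perp y nW)).
move=> /vlineP[c e]; move/eqP: b0; apply; apply/eqP; rewrite -memv0 -(nondeg_cap nW).
by rewrite memv_cap pr_perp // andbT e memvZ ?pr_mem.
Qed.

(** * Commutation preserving maps and frames *)

Section SubspaceMap.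
Variables n k : nat.
Hypotheses (k0 : (0 < k)%N) (kn : (2 * k < n)%N) (nk : (5 <= n - k)%N).
Hypothesis hdim : \dim {:V} = (2 * n)%N.

(* The subspaces S_+(u) of the (2k, 2n - 2k)-involutions u. *)
Definition gr W := nondeg W && (\dim W == 2 * k)%N.

Lemma gr_sumI (P : 'I_n -> {vspace V}) (I : {set 'I_n}) : frame P -> #|I| = k -> gr (sumI P I).
Proof. by move=> fP cI; rewrite /gr sumI_nondeg // dim_sumI // cI eqxx. Qed.

(* Centralizers are taken inside gr, so this notion only involves commutation and
   is transported by f. *)
Definition exact_family (X : {vspace V} -> Prop) := forall U W, gr U -> gr W ->
  (forall Z, X Z -> comm U Z) -> (forall Z, X Z -> comm W Z) -> comm U W.

(** For [j] other than [i], some set of [X] separates the two. As [pr W] commutes with the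
    projection onto its sum, [pr W] maps [P i] to vectors without component in [P j]; so [P i] is
    stable under [pr W]. *)
Lemma separating_compat (P : 'I_n -> {vspace V}) (X : pred {set 'I_n}) W : frame P ->
  separating X -> nondeg W -> (forall I, X I -> comm W (sumI P I)) ->
  forall i, (P i <= W)%VS \/ (P i <= perp W)%VS.
Proof.
move=> fP sX nW cW i; apply: hyp_stable (fP.1 i) nW _ => x xi.
have -> : P i = sumI P [set i] by rewrite /sumI big_set1.
apply/(sumIP fP hdim) => j; rewrite inE => ji.
have [I XI sI] := sX j i ji; have nI := sumI_nondeg fP I.
have cI := cW I XI; case: (boolP (i \in I)) => iI.
  have xI : x \in sumI P I by apply: (subvP (mem_sumI P iI)).
  have /(sumIP fP hdim) := comm_mem nI cI xI; apply.
  by move: sI; rewrite /sep iI; case: (j \in I).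
have jI : j \in I by move: sI; rewrite /sep (negbTE iI); case: (j \in I).
have : pr (P j) (pr (sumI P I) (pr W x)) = 0.
  have -> : pr (sumI P I) (pr W x) = pr W (pr (sumI P I) x) by rewrite cI.
  rewrite pr_sumI // big1 ?pr0 // => l lI.
  by rewrite (frame_pr0 fP _ xi) //; apply: contraNneq iI => ->.
by rewrite pr_pr_sumI // jI.
Qed.

(* Replaces the planes <x, y> and <z, t> with indices i and j by another orthogonal
   decomposition of their sum; the new planes do not commute with the old ones. *)
Definition twist (P : 'I_n -> {vspace V}) i j x y z t (l : 'I_n) :=
  if l == i then line2 (x + z) y else if l == j then line2 z (t - y) else P l.

Lemma twist_frame (P : 'I_n -> {vspace V}) i j x y z t : frame P -> i != j -> '[x, y] = 1 ->
  '[z, t] = 1 ->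
  P i = line2 x y -> P j = line2 z t -> frame (twist P i j x y z t).
Proof.
move=> fP ij xy zt ePi ePj.
have xi : x \in P i by rewrite ePi line2l.
have yi : y \in P i by rewrite ePi line2r.
have zj : z \in P j by rewrite ePj line2l.
have tj : t \in P j by rewrite ePj line2r.
have o u v : u \in P i -> v \in P j -> '[u, v] = 0.
  by move=> ui; apply: perpx; apply: (subvP (fP.2 _ _ ij)).
have o' u v : u \in P i -> v \in P j -> '[v, u] = 0.
  by move=> ui vj; rewrite omC o // oppr0.
have oe := (o x z, o x t, o y z, o y t, o' x z, o' x t, o' y z, o' y t).
rewrite /twist; split=> [l|a b].
  case: eqP => _; first by apply: hyp_line2; rewrite !omE xy o' // addr0 oner_neq0.
  case: eqP => _; first by apply: hyp_line2; rewrite !omE zt o' // oppr0 addr0 oner_neq0.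
  exact: fP.1.
have fPl l : l != i -> l != j -> [/\ P l <= perp (P i) & P l <= perp (P j)]%VS.
  by move=> li lj; split; apply: fP.2.
(* Orthogonality is symmetric, so [i], or else [j], may be assumed to be [a] if it occurs at all. *)
wlog : a b / (a == i) || (b != i) && ((a == j) || (b != j)).
  move=> H ab; case: (boolP ((a == i) || (b != i) && ((a == j) || (b != j)))).
    by move=> h; apply: H.
  move=> h; rewrite orthov_sym; apply: H; last by rewrite eq_sym.
  by move: h; case: (a == i); case: (b == i); case: (a == j); case: (b == j).
move=> h ab; have ba : b != a by rewrite eq_sym.
case: (eqVneq a i) => [e|ai].
  subst a; rewrite (negbTE ba); case: (eqVneq b j) => [_|bj].
    rewrite line2S !perp_line2 !omE !oe // zt xy.
    by rewrite ?(addr0, add0r, oppr0, subr0, addNr, eqxx).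
  have [h1 h2] := fPl b ba bj.
  by rewrite orthov_sym; apply/subvP => u ub; rewrite perp_line2 !omE
    (perpx (subvP h1 _ ub) xi) (perpx (subvP h1 _ ub) yi) (perpx (subvP h2 _ ub) zj) addr0 eqxx.
move: h; rewrite (negbTE ai) /= => /andP[bi]; rewrite (negbTE bi).
case: (eqVneq a j) => [e _|aj /= bj].
  subst a; rewrite (negbTE ba); have [h1 h2] := fPl b bi ba.
  by rewrite orthov_sym; apply/subvP => u ub; rewrite perp_line2 !omE
    (perpx (subvP h1 _ ub) yi) (perpx (subvP h2 _ ub) zj) (perpx (subvP h2 _ ub) tj) subr0 eqxx.
by rewrite (negbTE bj); apply: fP.2.
Qed.

(** The new planes lie in [P i + P j], which [I] takes in wholly or not at all; inclusion suffices
    since the dimensions agree. *)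
Lemma twist_sumI (P : 'I_n -> {vspace V}) i j x y z t (I : {set 'I_n}) : frame P -> i != j ->
  '[x, y] = 1 -> '[z, t] = 1 ->
  P i = line2 x y -> P j = line2 z t -> (i \in I) = (j \in I) ->
  sumI (twist P i j x y z t) I = sumI P I.
Proof.
move=> fP ij xy zt ePi ePj eI; have fQ := twist_frame fP ij xy zt ePi ePj.
apply/eqP; rewrite eqEdim !dim_sumI // leqnn andbT; apply/subv_sumP => l lI.
have sub u w : w \in I -> u \in P w -> u \in sumI P I.
  by move=> wI; apply: (subvP (mem_sumI P wI)).
have inP : i \in I -> [/\ x \in sumI P I, y \in sumI P I, z \in sumI P I & t \in sumI P I].
  move=> iI; have jI := iI; rewrite eI in jI.
  by split; [apply: (sub _ i)|apply: (sub _ i)|apply: (sub _ j)|apply: (sub _ j)];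
    rewrite // ?ePi ?ePj ?line2l ?line2r.
rewrite /twist; case: (eqVneq l i) => [e|li].
  by rewrite e in lI; have [? ? ? ?] := inP lI; rewrite line2S memvD.
case: (eqVneq l j) => [e|lj]; last exact: mem_sumI.
by rewrite e -eI in lI; have [? ? ? ?] := inP lI; rewrite line2S memvB // andbT.
Qed.

(** A separating family forces whatever commutes with it to be a sum of planes of [P]. If [i] and
    [j] stay unseparated, the twisted frame has the same sums over the sets of [X]; for [I]
    containing [i] but not [j], the old and the new sum over [I] centralize the family without
    commuting. *)
Lemma exact_sumI (P : 'I_n -> {vspace V}) (X : pred {set 'I_n}) : frame P ->
  (forall I : {set 'I_n}, X I -> #|I| = k) ->
  separating X <-> exact_family (fun Z => exists2 I, X I & Z = sumI P I).
Proof.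
move=> fP Xk; split=> [sX U W /andP[nU _] /andP[nW _] cU cW | eX].
  have HU := separating_compat fP sX nU (fun I XI => cU _ (ex_intro2 _ _ I XI erefl)).
  have HW := separating_compat fP sX nW (fun I XI => cW _ (ex_intro2 _ _ I XI erefl)).
  rewrite (compat_sumI fP hdim nU HU) (compat_sumI fP hdim nW HW).
  exact: comm_sumI.
apply: contrapT => /not_separating[i [j [ij H]]].
have [x [y [xy ePi]]] := hyp_basis (fP.1 i).
have [z [t [zt ePj]]] := hyp_basis (fP.1 j).
pose Q := twist P i j x y z t; have fQ : frame Q by apply: twist_frame.
have eQ I : X I -> sumI Q I = sumI P I.
  move=> /H; rewrite /sep negbK => /eqP; exact: twist_sumI.
have [||| I [cI sI nI]] := @kset_between n k [:: i] [:: j]; rewrite //= ?inE ?orbF //; first lia.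
have : comm (sumI P I) (sumI Q I).
  apply: eX; rewrite ?gr_sumI // => Z [J XJ ->]; first exact: comm_sumI.
  by rewrite -eQ //; apply: comm_sumI.
have iI : i \in I by move: sI; rewrite /= andbT.
have jI : j \notin I by move: nI; rewrite /= !inE andbT.
have nPI := sumI_nondeg fP I; have nQI := sumI_nondeg fQ I.
have xi : x \in P i by rewrite ePi line2l.
have zj : z \in P j by rewrite ePj line2l.
have xI : x \in sumI P I by apply: (subvP (mem_sumI P iI)).
have zI : z \in perp (sumI P I).
  by rewrite (perp_sumIE fP hdim); apply: (subvP (mem_sumI P _) _ zj); rewrite inE.
have xzQ : x + z \in sumI Q I.
  by apply: (subvP (mem_sumI Q iI)); rewrite /Q /twist eqxx line2l.
have tyQ : t - y \in perp (sumI Q I).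
  rewrite (perp_sumIE fQ hdim); have jI' : j \in ~: I by rewrite inE.
  by apply: (subvP (mem_sumI Q jI')); rewrite /Q /twist eq_sym (negbTE ij) eqxx line2r.
(* If the sums commuted, the component [x] of [x + z] in the old sum would lie in the new one; but
   [t - y] is orthogonal to the new sum, and its product with [x] is -1. *)
move=> c; have := comm_mem nQI c xzQ.
rewrite prD (pr_id nPI xI) (pr_0 nPI zI) addr0 => xQ.
have := perpxC xQ tyQ; rewrite !omE xy (perpx (U := P j)) ?ePj ?line2r -?ePj //; last first.
  exact: (subvP (fP.2 _ _ ij)).
by move/eqP; rewrite add0r oppr_eq0 oner_eq0.
Qed.

Variables f f' : {vspace V} -> {vspace V}.
Hypothesis f_gr : forall W, gr W -> gr (f W).
Hypothesis f'_gr : forall W, gr W -> gr (f' W).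
Hypothesis fK : forall W, gr W -> f' (f W) = W.
Hypothesis f'K : forall W, gr W -> f (f' W) = W.
Hypothesis f_comm : forall U W, gr U -> gr W -> comm U W <-> comm (f U) (f W).

Lemma exact_family_image X : (forall Z, X Z -> gr Z) ->
  exact_family X <-> exact_family (fun Z => exists2 Y, X Y & Z = f Y).
Proof.
move=> Xg; split=> eX U W gU gW cU cW.
  rewrite -(f'K gU) -(f'K gW); apply/(f_comm (f'_gr gU) (f'_gr gW)).
  apply: eX; rewrite ?f'_gr // => Z XZ; apply/(f_comm (f'_gr _) (Xg _ XZ)) => //.
    by rewrite f'K //; apply: cU; exists Z.
  by rewrite f'K //; apply: cW; exists Z.
apply/(f_comm gU gW); apply: eX; rewrite ?f_gr // => _ [Z XZ ->].
  by apply/(f_comm gU (Xg _ XZ)); apply: cU.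
by apply/(f_comm gW (Xg _ XZ)); apply: cW.
Qed.

Lemma exact_family_ext X Y : (forall Z, X Z <-> Y Z) -> exact_family X -> exact_family Y.
Proof. by move=> e H U W gU gW cU cW; apply: H => // Z /e; [apply: cU | apply: cW]. Qed.

Definition frame_image (P Q : 'I_n -> {vspace V}) := [/\ frame P, frame Q &
  forall I : {set 'I_n}, #|I| = k -> f (sumI P I) = sumI Q I].

Lemma frame_comp (P : 'I_n -> {vspace V}) (t : 'I_n -> 'I_n) : injective t -> frame P ->
  frame (P \o t).
Proof.
move=> ti fP; split=> [i|i j ij] /=; first exact: fP.1.
by apply: fP.2; rewrite (inj_eq ti).
Qed.

Lemma sumI_comp (P : 'I_n -> {vspace V}) (t : 'I_n -> 'I_n) (I : {set 'I_n}) : injective t ->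
  sumI (P \o t) I = sumI P (t @: I).
Proof. by move=> ti; rewrite /sumI big_imset //= => i j _ _; apply: ti. Qed.

Lemma frame_image_comp (P Q : 'I_n -> {vspace V}) (t : 'I_n -> 'I_n) : injective t ->
  frame_image P Q -> frame_image (P \o t) (Q \o t).
Proof.
move=> ti [fP fQ H]; split; rewrite ?frame_comp //; try exact: frame_comp.
by move=> I cI; rewrite (sumI_comp P I ti) (sumI_comp Q I ti) H // card_imset.
Qed.

(** The images of the sums of [P] commute pairwise, so they are sums over one common frame.
    Exactness, which [f] preserves, becomes separation on both sides, and the resulting permutation
    only reindexes that frame. *)
Lemma frame_image_exists (P : 'I_n -> {vspace V}) : frame P -> exists Q : 'I_n ->
  {vspace V}, frame_image P Q.
Proof.
move=> fP; pose L := map (fun I => f (sumI P I)) (enum [set I : {set 'I_n} | #|I| == k]).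
have LP W : W \in L -> exists2 I : {set 'I_n}, #|I| = k & W = f (sumI P I).
  by case/mapP => I; rewrite mem_enum inE => /eqP cI ->; exists I.
have gf (I : {set 'I_n}) : #|I| = k -> gr (f (sumI P I)) by move=> cI; rewrite f_gr ?gr_sumI.
have [||||s [hs es Hs]] := @comm_family_hseq L fullv.
- by rewrite /nondeg addvC addvf.
- by move=> W /LP[I cI ->]; case/andP: (gf I cI).
- move=> W W' /LP[I cI ->] /LP[J cJ ->].
  by rewrite -f_comm ?gr_sumI //; apply: comm_sumI.
- by move=> W x _ _; rewrite memvf.
have sn : size s = n by move: (hseq_dim hs); rewrite es hdim; lia.
pose Q0 := fun i : 'I_n => nth 0%VS s i; have fQ0 : frame Q0 := hseq_frame sn hs.
pose g (I : {set 'I_n}) := [set i | (Q0 i <= f (sumI P I))%VS].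
have gE (I : {set 'I_n}) : #|I| = k -> f (sumI P I) = sumI Q0 (g I).
  move=> cI; apply: (compat_sumI fQ0 hdim); first by case/andP: (gf I cI).
  move=> i; apply: Hs; first by rewrite mem_nth ?sn.
  by apply/mapP; exists I; rewrite // mem_enum inE cI.
have [||||||t ti tP] := @ksubset_map_induced n k _ _ _ g => //.
- move=> I cI; have /andP[_] := gf I cI; rewrite gE // dim_sumI //.
  by rewrite eqn_pmul2l // => /eqP.
- move=> I J cI cJ e; apply: (sumI_inj fP hdim).
  by rewrite -(fK (gr_sumI fP cI)) -(fK (gr_sumI fP cJ)) !gE // e.
- move=> X Xk; rewrite (exact_sumI fP Xk) exact_family_image; last first.
    by move=> Z [I /Xk cI ->]; apply: gr_sumI.
  rewrite (exact_sumI fQ0); last first.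
    move=> J /existsP[I /andP[XI /eqP ->]]; have cI := Xk I XI.
    by have /andP[_] := gf I cI; rewrite gE // dim_sumI // eqn_pmul2l // => /eqP.
  split; apply: exact_family_ext => Z; split.
  + move=> [_ [I XI ->] ->]; exists (g I); last by rewrite gE ?Xk.
    by apply/existsP; exists I; rewrite XI eqxx.
  + move=> [J /existsP[I /andP[XI /eqP ->]] ->]; exists (sumI P I); first by exists I.
    by rewrite gE ?Xk.
  + move=> [J /existsP[I /andP[XI /eqP ->]] ->]; exists (sumI P I); first by exists I.
    by rewrite gE ?Xk.
  + move=> [_ [I XI ->] ->]; exists (g I); last by rewrite gE ?Xk.
    by apply/existsP; exists I; rewrite XI eqxx.
exists (Q0 \o t); split=> //; first exact: frame_comp.
by move=> I cI; rewrite gE // tP // (sumI_comp Q0 I ti).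
Qed.

Lemma cap_avoid (i a b : 'I_n) : i != a -> i != b -> exists I J : {set 'I_n},
  [/\ #|I| = k, #|J| = k, I :&: J = [set i],
    [/\ a \notin I & b \notin I] & [/\ a \notin J & b \notin J]].
Proof.
move=> ia ib.
have [||| I [cI sI nI]] := @kset_between n k [:: i] [:: a; b];
  rewrite /= ?inE ?orbF ?negb_or ?ia //; first lia.
move: sI nI; rewrite /= !andbT !inE => iI /andP[aI bI].
have sz : size (enum (I :\ i)) = k.-1 by rewrite -cardE (cardsD1 i) iI in cI *; rewrite -cI.
(* [J] also avoids the other [k - 1] members of [I]; the room for this is exactly [2 * k < n]. *)
have [||| J [cJ sJ nJ]] := @kset_between n k [:: i] [:: a, b & enum (I :\ i)].
- by rewrite /= orbF !inE negb_or ia mem_enum !inE eqxx orbF.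
- by [].
- by rewrite /= sz; lia.
move: sJ nJ; rewrite /= andbT !inE => iJ /and3P[aJ bJ /allP nJ].
exists I, J; split=> //; apply/setP => l; rewrite !inE; apply/andP/eqP => [[lI lJ]|-> //].
apply/eqP/negPn/negP => li; have := nJ l; rewrite mem_enum !inE li lI lJ.
by move/(_ isT).
Qed.

(** [Q i] is the intersection of the images of two sums over k-subsets that share only [i] and avoid
    [a] and [b]; both sums are the same for the two frames. *)
Lemma frame_image_eq_off (P P' Q Q' : 'I_n -> {vspace V}) (i a b : 'I_n) : frame_image P Q ->
  frame_image P' Q' -> i != a -> i != b ->
  (forall j, j != a -> j != b -> P j = P' j) -> Q i = Q' i.
Proof.
move=> [fP fQ H] [fP' fQ' H'] ia ib e.
have [I [J [cI cJ IJ [aI bI] [aJ bJ]]]] := cap_avoid ia ib.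
have key (K : {set 'I_n}) : a \notin K -> b \notin K -> #|K| = k -> sumI Q K = sumI Q' K.
  move=> aK bK cK; rewrite -H // -H' //; congr f; apply: eq_bigr => j jK.
  by apply: e; [apply: contraNneq aK => <- | apply: contraNneq bK => <-].
have := congr2 capv (key I aI bI cI) (key J aJ bJ cJ).
by rewrite !(sumI_cap _ hdim) // IJ /sumI !big_set1.
Qed.

(** * Independence of the image of a plane from the frame *)

Lemma n_gt0 : (0 < n)%N.
Proof. by move: kn; clear; lia. Qed.
Let i0 : 'I_n := Ordinal n_gt0.

Definition seqf (s : seq {vspace V}) : 'I_n -> {vspace V} := fun i => nth 0%VS s i.

(** Quantified over all images, so that chaining requires the middle list to have one; being an
    [hseq] of size [n] guarantees it. *)
Definition same_head (s t : seq {vspace V}) := forall Q Q', frame_image (seqf s) Q ->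
  frame_image (seqf t) Q' ->
  Q i0 = Q' i0.

Lemma same_head_trans s t u : size t = n -> hseq t ->
  same_head s t -> same_head t u -> same_head s u.
Proof.
move=> tn ht st tu Q Q'' iQ iQ''.
have [Q' iQ'] := frame_image_exists (hseq_frame tn ht).
by rewrite (st _ _ iQ iQ') (tu _ _ iQ' iQ'').
Qed.

Lemma same_head_off s t i j : (0 < i < n)%N -> (0 < j < n)%N ->
  (forall l, l != i -> l != j -> nth 0%VS s l = nth 0%VS t l) -> same_head s t.
Proof.
move=> /andP[i1 i2] /andP[j1 j2] e Q Q' iQ iQ'.
apply: (@frame_image_eq_off _ _ _ _ i0 (Ordinal i2) (Ordinal j2) iQ iQ'); rewrite -?val_eqE /=;
  try lia.
by move=> l li lj; apply: e.
Qed.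

Lemma hseq_extend s : hseq s -> exists w, hseq (s ++ w) /\ size (s ++ w) = n.
Proof.
move=> hs; have nS := hseq_nondeg hs.
have [w [hw ew]] := nondeg_hseq (nondeg_perp nS).
have h : hseq (s ++ w) by rewrite hseq_cat hs hw ew perpK subvv.
exists w; split=> //; move: (hseq_dim h).
by rewrite big_cat /= ew (eqP nS) hdim; lia.
Qed.

(** A totally isotropic perpendicular of [U + <[y]>] would lie inside [U + <[y]>] and meet [U]
    trivially, hence have dimension at most 1; but its dimension is at least that of [V] minus that
    of [U] minus 1. *)
Lemma common_orth U y : nondeg U -> (\dim U + 3 <= \dim {:V})%N ->
  exists2 d, hyp d & (d <= perp (U + <[y]>))%VS.
Proof.
move=> nU dU; apply: hyp_in; apply/negP; rewrite perpK => h.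
have d1 : (\dim (U + <[y]>) <= \dim U + 1)%N.
  have [le _] := dimv_add_leqif U <[y]>; apply: leq_trans le _.
  by rewrite leq_add2l dim_vline leq_b1.
have hU : (U :&: perp (U + <[y]>) = 0)%VS.
  by apply/eqP; rewrite -subv0 -(nondeg_cap nU) capvS // perpS // addvSl.
have d2 : (\dim (U + perp (U + <[y]>)) <= \dim (U + <[y]>))%N.
  by apply: dimvS; rewrite subv_add addvSl.
rewrite (dimv_disjoint_sum hU) in d2.
by move: d1 d2 (dim_perp_ge (U + <[y]>)); lia.
Qed.

Lemma hseq_rcons s a : hseq (rcons s a) = [&& hseq s, hyp a & (a <= perp (\sum_(P <- s) P))%VS].
Proof. by rewrite -cats1 hseq_cat big_seq1 orthov_sym /hseq /= !andbT. Qed.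

Lemma nth_cat2 (s t t' : seq {vspace V}) l : (l < size s)%N ->
  nth 0%VS (s ++ t) l = nth 0%VS (s ++ t') l.
Proof. by move=> h; rewrite !nth_cat h. Qed.

(* Induction on the number of planes not shared.  Two hyperbolic planes orthogonal
   to the shared ones are joined by a chain in which neighbours are orthogonal: if
   [x, y] <> 0 with x in a and y in b, then <x, y> meets both a and b in a line, so
   that it has with each of them a common orthogonal hyperbolic plane. *)
Lemma same_head_frames r s t t' : (0 < size s)%N -> size t = r -> size t' = r ->
  (size s + r = n)%N -> hseq (s ++ t) -> hseq (s ++ t') -> same_head (s ++ t) (s ++ t').
Proof.
elim/ltn_ind: r s t t' => r IH s t t' s0 tr t'r sr ht ht'.
case: (ltnP r 3) => [r3|r3].
  case: (posnP r) => [r0|r0].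
    have -> : t = [::] by apply: size0nil; rewrite tr.
    have -> : t' = [::] by apply: size0nil; rewrite t'r.
    (* Both lists are [s]; the two exceptional indices are dummies and may coincide. *)
    by apply: (@same_head_off _ _ n.-1 n.-1) => //; lia.
  (* With one or two planes left, only the positions [size s] and [n.-1] can differ. *)
  apply: (@same_head_off _ _ (size s) n.-1); try lia.
  move=> l l1 l2; case: (ltnP l (size s)) => h; first exact: nth_cat2.
  by rewrite !nth_default ?size_cat ?tr ?t'r //; lia.
(* [link a b] compares all completions of [s], [a] with all completions of [s], [b]; for [a = b] it
   is the induction hypothesis. *)
pose link a b := forall w w', size w = r.-1 -> size w' = r.-1 ->
  hseq (rcons s a ++ w) -> hseq (rcons s b ++ w') -> same_head (rcons s a ++ w) (rcons s b ++ w').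
have hcomp a : hseq (rcons s a) -> exists w, hseq (rcons s a ++ w) /\ size w = r.-1.
  move=> ha; have [w [hw sw]] := hseq_extend ha; exists w; split=> //.
  by move: sw sr r3; rewrite size_cat size_rcons; clear; lia.
have link_trans a b c : hseq (rcons s b) -> link a b -> link b c -> link a c.
  move=> hb ab bc w w'' sw sw'' hw hw''; have [w' [hw' sw']] := hcomp b hb.
  apply: (@same_head_trans _ (rcons s b ++ w')) => //; last exact: bc.
    by move: sw' sr r3; rewrite size_cat size_rcons; clear; lia.
  exact: ab.
have link_same a w w' : size w = r.-1 -> size w' = r.-1 ->
    hseq (rcons s a ++ w) -> hseq (rcons s a ++ w') -> same_head (rcons s a ++ w) (rcons s a ++ w').
  by move=> *; apply: (IH r.-1); rewrite ?size_rcons //; move: sr r3; clear; lia.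
(* Orthogonal [a] and [b] fit into one frame, and exchanging them there changes just two
   positions. *)
have link_orth a b : hseq (rcons s a) -> hseq (rcons s b) -> (a <= perp b)%VS -> link a b.
  move=> ha hb ab w w' sw sw' hw hw'.
  have hab : hseq (rcons (rcons s a) b).
    rewrite hseq_rcons ha; move: hb; rewrite hseq_rcons => /and3P[_ -> hb] /=.
    by rewrite -cats1 big_cat big_seq1 /= perpsum subv_cap hb orthov_sym.
  have hba : hseq (rcons (rcons s b) a).
    rewrite hseq_rcons hb; move: ha; rewrite hseq_rcons => /and3P[_ -> ha] /=.
    by rewrite -cats1 big_cat big_seq1 /= perpsum subv_cap ha.
  have [v [hv sv]] := hseq_extend hab.
  have eab : (\sum_(P <- rcons (rcons s a) b) P = \sum_(P <- rcons (rcons s b) a) P)%VS.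
    by rewrite -!cats1 !big_cat !big_seq1 /= -!addvA [(a + b)%VS]addvC.
  have hv' : hseq (rcons (rcons s b) a ++ v).
    by move: hv; rewrite !hseq_cat hab hba eab.
  have sv' : size (b :: v) = r.-1 by move: sv sr r3; rewrite size_cat !size_rcons /=; clear; lia.
  apply: (@same_head_trans _ (rcons s a ++ b :: v)).
  - by move: sv' sr r3; rewrite size_cat size_rcons; clear; lia.
  - by rewrite -cat_rcons.
  - by apply: (link_same a) => //; rewrite -cat_rcons.
  apply: (@same_head_trans _ (rcons s b ++ a :: v)).
  - by move: sv' sr r3; rewrite size_cat size_rcons /=; clear; lia.
  - by rewrite -cat_rcons.
  - apply: (@same_head_off _ _ (size s) (size s).+1).
      by rewrite s0; move: sr r3; clear; lia.
      by move: sr r3; clear; lia.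
    move=> l l1 l2; rewrite !cat_rcons !nth_cat; case: ltnP => // h.
    have [m ->] : exists m, (l - size s)%N = m.+2 by exists (l - size s - 2)%N; move: h l1 l2;
      clear; lia.
    by [].
  - by apply: (link_same b) => //; rewrite -cat_rcons.
have link_all a b : hseq (rcons s a) -> hseq (rcons s b) -> link a b.
  move=> ha hb; case: (boolP (a <= perp b)%VS) => [|/nperpP[x [y [xa yb xy]]]].
    by move=> ab; exact: link_orth ha hb ab.
  move: (ha) (hb); rewrite !hseq_rcons => /and3P[hs pa oa] /and3P[_ pb ob].
  have hc : hseq (rcons s (line2 x y)).
    rewrite hseq_rcons hs hyp_line2 //= line2S (subvP oa) // (subvP ob) //.
  (* [c] and [line2 z w] share [z], so a hyperbolic plane orthogonal to [s], [c] and [w] is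
     orthogonal to both and links them. *)
  have step c z w : hseq (rcons s c) -> hseq (rcons s (line2 z w)) ->
      z \in c -> link c (line2 z w) /\ link (line2 z w) c.
    move=> hsc hzw zc.
    have nU := hseq_nondeg hsc.
    have [|d pd] := @common_orth _ w nU.
      by rewrite (hseq_dim hsc) size_rcons hdim; move: sr r3; clear; lia.
    rewrite perpsum subv_cap -cats1 big_cat big_seq1 /= perpsum subv_cap => /andP[/andP[ds dc] dw].
    have hd : hseq (rcons s d) by rewrite hseq_rcons hs pd.
    have dzw : (d <= perp (line2 z w))%VS.
      rewrite perpsum subv_cap dw andbT; apply: subv_trans dc _; apply: perpS.
      by rewrite -memvE.
    have cd : link c d by apply: link_orth => //; rewrite orthov_sym.
    have dc' : link d c by apply: link_orth.
    have dz : link d (line2 z w) by apply: link_orth.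
    have zd : link (line2 z w) d by apply: link_orth => //; rewrite orthov_sym.
    by split; apply: (link_trans _ d).
  apply: (link_trans _ (line2 x y)) => //; first by case: (step a x y).
  have yx : line2 x y = line2 y x by rewrite /line2 addvC.
  by move: hc; rewrite yx => hc; case: (step b y x).
case: t tr ht => [|a w] /= sw hw; first by move: r3; rewrite -sw.
case: t' t'r ht' => [|b w'] /= sw' hw'; first by move: r3; rewrite -sw'.
rewrite -!cat_rcons; apply: link_all; rewrite ?cat_rcons -?sw -?sw' //; last by rewrite sw -sw'.
  by move: hw; rewrite -cat_rcons hseq_cat => /and3P[].
by move: hw'; rewrite -cat_rcons hseq_cat => /and3P[].
Qed.

Lemma frame_hseq (P : 'I_n -> {vspace V}) : frame P -> hseq [seq P i | i <- enum 'I_n].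
Proof.
move=> fP; rewrite /hseq; apply/andP; split.
  by apply/allP => _ /mapP[i _ ->]; apply: fP.1.
rewrite pairwise_map; have : uniq (enum 'I_n) by apply: enum_uniq.
rewrite uniq_pairwise; apply: sub_pairwise => i j /=; exact: fP.2.
Qed.

Lemma seqf_enum (P : 'I_n -> {vspace V}) : seqf [seq P i | i <- enum 'I_n] = P.
Proof. by apply: funext => i; rewrite /seqf (nth_map i) ?nth_ord_enum // size_enum_ord. Qed.

Lemma frame_image_head (P P' Q Q' : 'I_n -> {vspace V}) : frame_image P Q ->
  frame_image P' Q' -> P i0 = P' i0 -> Q i0 = Q' i0.
Proof.
move=> iQ iQ' e; have [fP _ _] := iQ; have [fP' _ _] := iQ'.
have sz (R : 'I_n -> {vspace V}) : size [seq R i | i <- enum 'I_n] = n.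
  by rewrite size_map size_enum_ord.
have hd (R : 'I_n -> {vspace V}) : nth 0%VS [seq R i | i <- enum 'I_n] 0 = R i0.
  by rewrite -[RHS]/(R i0) -{2}(seqf_enum R).
suff : same_head [seq P i | i <- enum 'I_n] [seq P' i | i <- enum 'I_n].
  by move=> sh; apply: (sh Q Q'); rewrite seqf_enum.
move: (frame_hseq fP) (frame_hseq fP') (sz P) (sz P') (hd P) (hd P').
case: [seq P i | i <- _] => [|a t] ht.
  by move=> _ n0; have h := n_gt0; rewrite -n0 in h.
case: [seq P' i | i <- _] => [|a' t'] ht'.
  by move=> _ n0; have h := n_gt0; rewrite -n0 in h.
move=> st st' /= ea ea'; subst a a'; move: ht'; rewrite -e => ht'.
have := @same_head_frames n.-1 [:: P i0] t t'; apply => //=.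
- by rewrite -st.
- by rewrite -st'.
- by rewrite add1n prednK ?n_gt0.
Qed.

Lemma frame_image_plane (P P' Q Q' : 'I_n -> {vspace V}) i j : frame_image P Q ->
  frame_image P' Q' ->
  P i = P' j -> Q i = Q' j.
Proof.
move=> /(frame_image_comp (@perm_inj _ (tperm i0 i))) iQ /(frame_image_comp (@perm_inj _ (tperm
  i0 j))) iQ' e.
by have := frame_image_head iQ iQ'; rewrite /= !tpermL; apply.
Qed.

(** * The bijection of hyperbolic planes *)

Lemma plane_map : exists h : {vspace V} -> {vspace V},
  forall P Q : 'I_n -> {vspace V}, frame_image P Q -> forall i, Q i = h (P i).
Proof.
have H X : exists Y, forall (P Q : 'I_n -> {vspace V}) i, frame_image P Q -> P i = X -> Q i = Y.
  case: (pselect (exists (P Q : 'I_n ->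
    {vspace V}) i, frame_image P Q /\ P i = X)) => [[P [Q [i [iQ <-]]]]|nX].
    by exists (Q i) => P' Q' j iQ' e; apply: frame_image_plane iQ' iQ e.
  (* Subspaces that occur in no frame with an image get a dummy value. *)
  by exists 0%VS => P Q i iQ e; case: nX; exists P, Q, i.
have [h hP] := choice H; exists h => P Q iQ i; exact: (hP _ P Q i).
Qed.

Lemma hseq_in_frame s : hseq s -> exists P : 'I_n -> {vspace V},
  frame P /\ forall l (h : (l < n)%N), (l < size s)%N -> P (Ordinal h) = nth 0%VS s l.
Proof.
move=> hs; have [w [hw sw]] := hseq_extend hs; exists (seqf (s ++ w)); split.
  exact: hseq_frame.
by move=> l h ls; rewrite /seqf /= nth_cat ls.
Qed.

Lemma hyp_in_frame X : hyp X -> exists (P : 'I_n -> {vspace V}) i, frame P /\ P i = X.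
Proof.
move=> hX; have [|P [fP eP]] := @hseq_in_frame [:: X]; first by rewrite /hseq /= hX.
by exists P, i0; split=> //; rewrite eP.
Qed.

Lemma orth_in_frame X Y : hyp X -> hyp Y -> (X <= perp Y)%VS ->
  exists (P : 'I_n -> {vspace V}) i j, [/\ frame P, i != j, P i = X & P j = Y].
Proof.
move=> hX hY XY; have [|P [fP eP]] := @hseq_in_frame [:: X; Y].
  by rewrite /hseq /= hX hY XY.
have n1 : (1 < n)%N by move: kn k0; clear; lia.
by exists P, i0, (Ordinal n1); split=> //; rewrite eP.
Qed.

End SubspaceMap.

(** Every hyperbolic plane and every orthogonal pair of them lies in a frame, where [h] is read off
    from a frame image. Read backwards, a frame image for [f] is one for [f'], so [h'] inverts
    [h]. *)
Theorem plane_bijection n k (k0 : (0 < k)%N) (kn : (2 * k < n)%N) (nk : (5 <= n - k)%N)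
  (hdim : \dim {:V} = (2 * n)%N) (f f' : {vspace V} -> {vspace V})
  (f_gr : forall W, gr k W -> gr k (f W)) (f'_gr : forall W, gr k W -> gr k (f' W))
  (fK : forall W, gr k W -> f' (f W) = W) (f'K : forall W, gr k W -> f (f' W) = W)
  (f_comm : forall U W, gr k U -> gr k W -> comm U W <-> comm (f U) (f W)) :
  exists h h' : {vspace V} -> {vspace V},
   [/\ forall X, hyp X -> hyp (h X) /\ hyp (h' X),
       forall X, hyp X -> h' (h X) = X /\ h (h' X) = X,
       forall X Y, hyp X -> hyp Y -> (X <= perp Y)%VS -> (h X <= perp (h Y))%VS,
       forall X Y, hyp X -> hyp Y -> (X <= perp Y)%VS -> (h' X <= perp (h' Y))%VS &
       forall (P : 'I_n -> {vspace V}) (I : {set 'I_n}), frame P -> #|I| = k ->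
         f (sumI P I) = sumI (h \o P) I].
Proof.
have f'_comm U W : gr k U -> gr k W -> comm U W <-> comm (f' U) (f' W).
  by move=> gU gW; rewrite (f_comm _ _ (f'_gr _ gU) (f'_gr _ gW)) !f'K.
have [h hE] := plane_map k0 kn nk hdim f_gr f'_gr fK f'K f_comm.
have [h' h'E] := plane_map k0 kn nk hdim f'_gr f_gr f'K fK f'_comm.
have img_inv g g' (P Q : 'I_n -> {vspace V}) : (forall W, gr k W -> g' (g W) = W) ->
    frame_image k g P Q -> frame_image k g' Q P.
  move=> gK [fP fQ H]; split=> // I cI; rewrite -H // gK // gr_sumI //.
have key X : hyp X -> exists (P Q : 'I_n ->
  {vspace V}) i, [/\ frame_image k f P Q, P i = X & Q i = h X].
  move=> /(hyp_in_frame k0 kn nk hdim)[P [i [fP <-]]].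
  have [Q iQ] := frame_image_exists k0 kn nk hdim f_gr f'_gr fK f'K f_comm fP.
  by exists P, Q, i; split=> //; apply: hE.
have key' X : hyp X -> exists (P Q : 'I_n ->
  {vspace V}) i, [/\ frame_image k f' P Q, P i = X & Q i = h' X].
  move=> /(hyp_in_frame k0 kn nk hdim)[P [i [fP <-]]].
  have [Q iQ] := frame_image_exists k0 kn nk hdim f'_gr f_gr f'K fK f'_comm fP.
  by exists P, Q, i; split=> //; apply: h'E.
exists h, h'; split.
- move=> X hX; have [P [Q [i [[_ fQ _] _ <-]]]] := key X hX.
  by have [P' [Q' [i' [[_ fQ' _] _ <-]]]] := key' X hX; split; [apply: fQ.1 | apply: fQ'.1].
- move=> X hX; have [P [Q [i [iQ eX <-]]]] := key X hX.
  have [P' [Q' [i' [iQ' eX' <-]]]] := key' X hX.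
  have /h'E <- := img_inv _ _ _ _ fK iQ.
  by have /hE <- := img_inv _ _ _ _ f'K iQ'.
- move=> X Y hX hY /(orth_in_frame k0 kn nk hdim hX hY)[P [i [j [fP ij <- <-]]]].
  have [Q iQ] := frame_image_exists k0 kn nk hdim f_gr f'_gr fK f'K f_comm fP.
  by rewrite -!(hE _ _ iQ); have [_ fQ _] := iQ; apply: fQ.2.
- move=> X Y hX hY /(orth_in_frame k0 kn nk hdim hX hY)[P [i [j [fP ij <- <-]]]].
  have [Q iQ] := frame_image_exists k0 kn nk hdim f'_gr f_gr f'K fK f'_comm fP.
  by rewrite -!(h'E _ _ iQ); have [_ fQ _] := iQ; apply: fQ.2.
- move=> P I fP cI.
  have [Q iQ] := frame_image_exists k0 kn nk hdim f_gr f'_gr fK f'K f_comm fP.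
  have [_ _ ->] := iQ => //; apply: eq_bigr => i _; exact: hE.
Qed.

(** * From hyperbolic planes to points *)

Record plane_iso (h h' : {vspace V} -> {vspace V}) : Prop := PlaneIso {
  pi_hyp : forall X, hyp X -> hyp (h X);
  pi_hyp' : forall X, hyp X -> hyp (h' X);
  piK : forall X, hyp X -> h' (h X) = X;
  piK' : forall X, hyp X -> h (h' X) = X;
  pi_orth : forall X Y, hyp X -> hyp Y -> (X <= perp Y)%VS -> (h X <= perp (h Y))%VS;
  pi_orth' : forall X Y, hyp X -> hyp Y -> (X <= perp Y)%VS -> (h' X <= perp (h' Y))%VS }.

Lemma plane_iso_sym h h' : plane_iso h h' -> plane_iso h' h.
Proof. by case. Qed.

Section Points.
Hypothesis dim9 : (9 <= \dim {:V})%N.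

Lemma hyp_dim P : hyp P -> \dim P = 2%N.
Proof. by case/andP => /eqP. Qed.

(** A vector [z] of [W] orthogonal to [y] is the difference of [z + x] and [x], neither of which is
    orthogonal to [y]. *)
Lemma hyp_span W U : ~~ (W <= perp W)%VS ->
  (forall X, hyp X -> (X <= W)%VS -> (X <= U)%VS) -> (W <= U)%VS.
Proof.
move=> /nperpP[x [y [xW yW xy]]] H; apply/subvP => z zW.
have sub u v : u \in W -> v \in W -> '[u, v] != 0 -> u \in U.
  move=> uW vW uv; apply: (subvP (H _ (hyp_line2 uv) _) _ (line2l u v)).
  by rewrite line2S uW.
case: (eqVneq '[z, y] 0) => [zy|]; last exact: sub.
rewrite -(addrK x z) memvB ?(sub x y) // (sub _ y) ?memvD //.
by rewrite omDl zy add0r.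
Qed.

(** The perpendicular of [P + Q] is spanned by its hyperbolic planes unless it is totally isotropic.
    In that case it would lie in [P + Q], of dimension at most 4, while its own dimension is at
    least 9 - 4. *)
Lemma sub_sum_orthP P Q R : hyp P -> hyp Q -> hyp R ->
  (R <= P + Q)%VS <->
  forall X, hyp X -> (X <= perp P)%VS -> (X <= perp Q)%VS -> (X <= perp R)%VS.
Proof.
move=> hP hQ hR; split=> [RPQ X hX XP XQ|H].
  by apply: subv_trans (perpS RPQ); rewrite perpsum subv_cap XP.
rewrite -[X in (_ <= X)%VS]perpK orthov_sym; apply: hyp_span.
  apply/negP; rewrite perpK => /dimvS le; have := dim_perp_ge (P + Q).
  have [le' _] := dimv_add_leqif P Q; rewrite (hyp_dim hP) (hyp_dim hQ) in le'.
  by move: dim9 le le'; clear; lia.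
by move=> X hX; rewrite perpsum subv_cap => /andP[]; apply: H.
Qed.

Lemma dim_hyp_sum P Q : hyp P -> hyp Q -> P != Q -> (3 <= \dim (P + Q))%N.
Proof.
move=> hP hQ PQ; rewrite -(hyp_dim hP) ltn_neqAle dimvS ?addvSl // andbT.
rewrite (dimv_leqif_eq (addvSl P Q)); apply: contra PQ => /eqP e.
by rewrite eq_sym eqEdim hyp_dim // hyp_dim // leqnn andbT e addvSr.
Qed.

(* With sub_sum_orthP this expresses that two planes meet in terms of orthogonality
   only.  If P :&: Q = 0, then P + Q has dimension 4 and contains a hyperbolic plane
   R' meeting P in a line, so that P + R' does not contain Q. *)
Lemma hyp_meetP P Q : hyp P -> hyp Q -> P != Q ->
  (P :&: Q != 0)%VS <-> forall R R', hyp R -> hyp R' -> R != R' ->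
    (R <= P + Q)%VS -> (R' <= P + Q)%VS -> (P <= R + R')%VS /\ (Q <= R + R')%VS.
Proof.
move=> hP hQ PQ; have dPQ := dimv_sum_cap P Q.
rewrite (hyp_dim hP) (hyp_dim hQ) in dPQ.
split=> [m0 R R' hR hR' RR' sR sR'|H].
  have sRR : (R + R' <= P + Q)%VS by rewrite subv_add sR.
  have eRR : (R + R' = P + Q)%VS.
    apply/eqP; rewrite eqEdim sRR /=; apply: leq_trans (dim_hyp_sum hR hR' RR').
    by move: m0 dPQ; rewrite -dimv_eq0; clear; lia.
  by rewrite eRR addvSl addvSr.
apply/negP => /eqP m0; rewrite m0 dimv0 addn0 in dPQ.
have [e [f [ef eP]]] := hyp_basis hP.
have [z [zQ z0 zf]] : exists z, [/\ z \in Q, z != 0 & '[e + z, f] != 0].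
  have q0 : vpick Q != 0 by rewrite vpick0 -dimv_eq0 (hyp_dim hQ).
  have qQ := memv_pick Q.
  case: (eqVneq '[e + vpick Q, f] 0) => [h|]; last by exists (vpick Q).
  (* If [e + q] is orthogonal to [f], then [e - q] has product 2 with [f]. *)
  exists (- vpick Q); rewrite memvN oppr_eq0; split=> //.
  move: h; rewrite !omE ef => /eqP; rewrite addr_eq0 => /eqP <-.
  exact: two_neq0.
have eQ : e \in P by rewrite eP line2l.
have fQ : f \in P by rewrite eP line2r.
have zPQ : z \in (P + Q)%VS by apply: (subvP (addvSr P Q)).
have [|||h1 h2] := H P (line2 (e + z) f) hP (hyp_line2 zf).
- apply/eqP => h; move/eqP: z0; apply; apply/eqP; rewrite -memv0 -m0 memv_cap zQ andbT.
  have -> : z = e + z - e by rewrite addrC addKr.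
  by rewrite memvB //; have := line2l (e + z) f; rewrite -h.
- exact: addvSl.
- by rewrite line2S memvD ?(subvP (addvSl P Q) _ eQ) ?(subvP (addvSl P Q) _ fQ).
have s : (P + line2 (e + z) f <= P + <[z]>)%VS.
  rewrite subv_add addvSl line2S (subvP (addvSl _ _) _ fQ) andbT.
  by rewrite memv_add // memv_line.
have /dimvS le : (P + Q <= P + <[z]>)%VS by apply: subv_trans s; rewrite subv_add h1.
have [le' _] := dimv_add_leqif P <[z]>; rewrite (hyp_dim hP) dim_vline z0 in le'.
by move: le le' dPQ; clear; lia.
Qed.

Section PlaneIso.
Variables h h' : {vspace V} -> {vspace V}.
Hypothesis iso : plane_iso h h'.

Lemma pi_inj P Q : hyp P -> hyp Q -> h P = h Q -> P = Q.
Proof. by move=> hP hQ e; rewrite -(piK iso hP) e (piK iso). Qed.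

Lemma pi_sum P Q R : hyp P -> hyp Q -> hyp R -> (R <= P + Q)%VS -> (h R <= h P + h Q)%VS.
Proof.
move=> hP hQ hR /(sub_sum_orthP hP hQ hR) H.
apply/(sub_sum_orthP (pi_hyp iso hP) (pi_hyp iso hQ) (pi_hyp iso hR)) => X hX XP XQ.
have hX' := pi_hyp' iso hX.
rewrite -(piK' iso hX); apply: (pi_orth iso) => //; apply: H => //.
  by rewrite -(piK iso hP); apply: (pi_orth' iso) => //; apply: pi_hyp iso _ _.
by rewrite -(piK iso hQ); apply: (pi_orth' iso) => //; apply: pi_hyp iso _ _.
Qed.
End PlaneIso.

Lemma pi_meet h h' P Q : plane_iso h h' -> hyp P -> hyp Q ->
  (P :&: Q != 0)%VS -> (h P :&: h Q != 0)%VS.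
Proof.
move=> iso hP hQ m0; have phP := pi_hyp iso hP; have phQ := pi_hyp iso hQ.
case: (eqVneq P Q) => [->|PQ]; first by rewrite capvv -dimv_eq0 (hyp_dim phQ).
have iso' := plane_iso_sym iso.
apply/(hyp_meetP phP phQ) => [|R R' hR hR' RR' sR sR'].
  by apply: contra PQ => /eqP /(pi_inj iso hP hQ) ->.
have qR := pi_hyp iso' hR; have qR' := pi_hyp iso' hR'.
have [|||s1 s2] := (hyp_meetP hP hQ PQ).1 m0 (h' R) (h' R') qR qR'.
- by apply: contra RR' => /eqP /(pi_inj iso' hR hR') ->.
- by rewrite -(piK iso hP) -(piK iso hQ); apply: (pi_sum iso').
- by rewrite -(piK iso hP) -(piK iso hQ); apply: (pi_sum iso').
by rewrite -(piK' iso hR) -(piK' iso hR'); split; apply: (pi_sum iso).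
Qed.

Lemma meet_neq0 U W x : x != 0 -> x \in U -> x \in W -> (U :&: W != 0)%VS.
Proof.
move=> x0 xU xW; apply: contra x0 => /eqP e.
by rewrite -memv0 -e memv_cap xU.
Qed.

Lemma vline_sub x y : x != 0 -> x \in <[y]>%VS -> y \in <[x]>%VS.
Proof.
move=> x0 /vlineP[c e]; have c0 : c != 0 by apply: contraNneq x0 => c0; rewrite e c0 scale0r.
by apply/vlineP; exists c^-1; rewrite e scalerA mulVf // scale1r.
Qed.

Lemma cap_line A B x : \dim A = 2%N -> (A <= B)%VS = false -> x != 0 -> x \in A -> x \in B ->
  (A :&: B)%VS = <[x]>%VS.
Proof.
move=> dA AB x0 xA xB; apply/esym/eqP; rewrite eqEdim -memvE memv_cap xA xB dim_vline x0 /=.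
rewrite -ltnS -dA ltn_neqAle dimvS ?capvSl // andbT.
by rewrite (dimv_leqif_eq (capvSl A B)); apply/negP => /eqP e; rewrite -e capvSr in AB.
Qed.

(** If [C] met [A] and [B] in different lines, it would be spanned by them and lie in [A + B]; so
    both lines are the common line [<[x]>] of [A] and [B]. *)
Lemma three_lines A B C x : \dim A = 2%N -> \dim B = 2%N -> \dim C = 2%N -> A != B ->
  x != 0 -> x \in A -> x \in B -> (C :&: A != 0)%VS -> (C :&: B != 0)%VS ->
  ~~ (C <= A + B)%VS -> x \in C.
Proof.
move=> dA dB dC AB x0 xA xB; rewrite -!vpick0; set a := vpick _; set b := vpick _.
move=> a0 b0 nC.
have := memv_pick (C :&: A); rewrite -/a memv_cap => /andP[aC aA].
have := memv_pick (C :&: B); rewrite -/b memv_cap => /andP[bC bB].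
have nAB : (A <= B)%VS = false.
  by apply/negP => s; case/negP: AB; rewrite eqEdim s dA dB.
have cAB := cap_line dA nAB x0 xA xB.
case: (boolP (a \in <[b]>%VS)) => [ab|nab].
  have aB : a \in B by have /vlineP[c ->] := ab; rewrite memvZ.
  have : a \in <[x]>%VS by rewrite -cAB memv_cap aA.
  by move=> /(vline_sub a0)/vlineP[c ->]; rewrite memvZ.
case/negP: nC; have -> : C = line2 a b.
  by apply/eqP; rewrite eq_sym eqEdim line2S aC bC dC dim_line2.
by rewrite line2S (subvP (addvSl A B) _ aA) (subvP (addvSr A B) _ bB).
Qed.

(** A partner [y] of [x] is modified by the vectors [z] and [t] of a hyperbolic plane orthogonal to
    [line2 x y]; their independence keeps the third plane out of the sum of the first two. *)
Lemma three_hyps x : x != 0 -> exists H1 H2 H3, [/\ hyp H1, hyp H2, hyp H3,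
  [/\ x \in H1, x \in H2 & x \in H3] & (H1 != H2) && ~~ (H3 <= H1 + H2)%VS].
Proof.
move=> x0; have [y xy] := om_neq0 x0; have hH1 := hyp_line2 xy.
have nH := nondeg_perp (hyp_nondeg hH1).
have [|D hD sD] := @hyp_in (perp (line2 x y)).
  apply/negP => h; have := dim_perp_ge (line2 x y); rewrite (hyp_dim hH1).
  have -> : perp (line2 x y) = 0%VS.
    by apply/eqP; rewrite -subv0 -(nondeg_cap nH) subv_cap subvv.
  by rewrite dimv0; move: dim9; clear; lia.
have [z [t [zt eD]]] := hyp_basis hD.
have zD : z \in perp (line2 x y) by apply: (subvP sD); rewrite eD line2l.
have tD : t \in perp (line2 x y) by apply: (subvP sD); rewrite eD line2r.
have xz : '[x, z] = 0 by apply: (perpxC (line2l x y) zD).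
have xt : '[x, t] = 0 by apply: (perpxC (line2l x y) tD).
have nz u : u \in line2 x y -> '[z, u] = 0 by apply: perpx.
exists (line2 x y), (line2 x (y + z)), (line2 x (y + t)); split.
- by [].
- by apply: hyp_line2; rewrite omDr xz addr0.
- by apply: hyp_line2; rewrite omDr xt addr0.
- by split; apply: line2l.
have key u a : u \in line2 x y -> u + a *: z = t -> False.
  move=> ul e; move: (oner_neq0 F); rewrite -zt -e omDr (nz _ ul) omZr omxx mulr0 addr0.
  by rewrite eqxx.
have s : (line2 x y + line2 x (y + z) <= line2 x y + <[z]>)%VS.
  rewrite subv_add addvSl line2S (subvP (addvSl _ _) _ (line2l x y)) /=.
  by rewrite memv_add ?line2r ?memv_line.
have nsub : ~~ (line2 x (y + t) <= line2 x y + line2 x (y + z))%VS.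
  apply/negP => /subvP /(_ _ (line2r _ _)) /(subvP s) /memv_addP[u ul [_ /vlineP[a ->] e]].
  apply: (key (u - y) a); first by rewrite memvB ?line2r.
  by rewrite addrAC -e [y + t]addrC addrK.
rewrite nsub andbT; apply/negP => /eqP e.
have zl : z \in line2 x y.
  have -> : z = y + z - y by rewrite addrC addKr.
  by rewrite memvB ?line2r //; have := line2r x (y + z); rewrite -e.
have := perpxC zl tD; rewrite zt => /eqP; by rewrite oner_eq0.
Qed.

Lemma cap_hyps x w : x != 0 -> (forall H, hyp H -> x \in H -> w \in H) -> w \in <[x]>%VS.
Proof.
move=> x0 H; have [H1 [H2 [_ [hH1 hH2 _ [x1 x2 _] /andP[H12 _]]]]] := three_hyps x0.
rewrite -(@cap_line H1 H2) ?hyp_dim //; first by rewrite memv_cap !H.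
by apply/negP => s; case/negP: H12; rewrite eqEdim s !hyp_dim.
Qed.

(** The image point is the intersection of [h H1] and [h H2]. A plane [h H] outside their sum passes
    through it by [three_lines]; one inside the sum meets [h H3], which has only that point in
    common with the sum. *)
Lemma point_image h h' x : plane_iso h h' -> x != 0 ->
  exists2 y, y != 0 & forall H, hyp H -> x \in H -> y \in h H.
Proof.
move=> iso x0; have iso' := plane_iso_sym iso.
have [H1 [H2 [H3 [p1 p2 p3 [x1 x2 x3] /andP[H12 n3]]]]] := three_hyps x0.
have q1 := pi_hyp iso p1; have q2 := pi_hyp iso p2; have q3 := pi_hyp iso p3.
have meet H K : hyp H -> hyp K -> x \in H -> x \in K -> (h H :&: h K != 0)%VS.
  by move=> hH hK xH xK; apply: (pi_meet iso) => //; apply: (meet_neq0 x0).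
have := meet _ _ p1 p2 x1 x2; rewrite -vpick0; set y := vpick _ => y0.
have := memv_pick (h H1 :&: h H2); rewrite -/y memv_cap => /andP[y1 y2].
have h12 : h H1 != h H2 by apply: contra H12 => /eqP /(pi_inj iso p1 p2) ->.
have m3 : ~~ (h H3 <= h H1 + h H2)%VS.
  by apply: contra n3 => /(pi_sum iso' q1 q2 q3); rewrite !(piK iso).
have y3 : y \in h H3.
  by apply: (@three_lines (h H1) (h H2)); rewrite ?hyp_dim ?meet.
exists y => // H hH xH; have qH := pi_hyp iso hH.
case: (boolP (h H <= h H1 + h H2)%VS) => [s|s]; last first.
  by apply: (@three_lines (h H1) (h H2)); rewrite ?hyp_dim ?meet.
have c3 := @cap_line (h H3) (h H1 + h H2)%VS y (hyp_dim q3) (negbTE m3) y0 y3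
  (subvP (addvSl _ _) _ y1).
have := meet _ _ hH p3 xH x3; rewrite -vpick0; set c := vpick _ => c0.
have := memv_pick (h H :&: h H3); rewrite -/c memv_cap => /andP[cH cH3].
have : c \in <[y]>%VS by rewrite -c3 memv_cap cH3 (subvP s).
by move/(vline_sub c0)/vlineP => [a ->]; rewrite memvZ.
Qed.

(** Vectors are non-orthogonal exactly when they are independent and lie in a common hyperbolic
    plane, and both conditions pass through [p] in either direction. [p] and [p'] only pick
    representatives of points, so they are inverse up to scalars. *)
Theorem point_bijection h h' : plane_iso h h' -> exists p p' : V -> V,
  [/\ forall x, x != 0 -> p x != 0 /\ p' x != 0,
      forall x, x != 0 -> p (p' x) \in <[x]>%VS,
      forall x y, x != 0 -> y != 0 -> ('[p x, p y] == 0) = ('[x, y] == 0),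
      forall H x, hyp H -> x != 0 -> x \in H -> p x \in h H &
      forall H x, hyp H -> x != 0 -> p x \in h H -> x \in H].
Proof.
move=> iso; have iso' := plane_iso_sym iso.
have ex g g' : plane_iso g g' -> forall x, exists y, x != 0 -> y != 0 /\ forall H, hyp H ->
  x \in H -> y \in g H.
  move=> gg' x; case: (eqVneq x 0) => [_|x0]; first by exists 0.
  by have [y y0 H] := point_image gg' x0; exists y.
have [p pP] := choice (ex _ _ iso); have [p' p'P] := choice (ex _ _ iso').
have p0 x : x != 0 -> p x != 0 by move=> /pP[].
have p'0 x : x != 0 -> p' x != 0 by move=> /p'P[].
have pH H x : hyp H -> x != 0 -> x \in H -> p x \in h H by move=> hH /pP[_]; apply.
have p'H H x : hyp H -> x != 0 -> x \in H -> p' x \in h' H by move=> hH /p'P[_]; apply.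
have pK x : x != 0 -> p' (p x) \in <[x]>%VS.
  move=> x0; apply: cap_hyps => // H hH xH; rewrite -(piK iso hH).
  by apply: p'H; rewrite ?p0 ?(pi_hyp iso) ?pH.
have p'K x : x != 0 -> p (p' x) \in <[x]>%VS.
  move=> x0; apply: cap_hyps => // H hH xH; rewrite -(piK' iso hH).
  by apply: pH; rewrite ?p'0 ?(pi_hyp' iso) ?p'H.
have pHV H x : hyp H -> x != 0 -> p x \in h H -> x \in H.
  move=> hH x0 /(p'H _ _ (pi_hyp iso hH) (p0 _ x0)); rewrite (piK iso hH) => xH.
  by have /vlineP[c ->] := vline_sub (p'0 _ (p0 _ x0)) (pK x x0); rewrite memvZ.
have sub u v : u != 0 -> v != 0 -> p u \in <[p v]>%VS -> u \in <[v]>%VS.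
  move=> u0 v0 /vlineP[c e]; apply: cap_hyps => // H hH vH.
  by apply: pHV => //; rewrite e memvZ // pH.
exists p, p'; split=> // x => [x0|y x0 y0]; first by split; [apply: p0 | apply: p'0].
apply/idP/idP => [|/eqP xy].
  apply: contraTT => nz; have hH := hyp_line2 nz; have pxH := pH _ _ hH x0 (line2l x y).
  have pyH := pH _ _ hH y0 (line2r x y).
  apply/negP => /eqP pxy; have := hyp_orth_line (pi_hyp iso hH) pxH pyH (p0 _ x0) pxy.
  by move=> /(sub _ _ y0 x0)/vlineP[c e]; move: nz; rewrite e !omE mulr0 eqxx.
apply/negPn/negP => nz.
have hK := hyp_line2 nz; have hK' := pi_hyp' iso hK.
have xK : x \in h' (line2 (p x) (p y)) by apply: pHV; rewrite // (piK' iso hK) line2l.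
have yK : y \in h' (line2 (p x) (p y)) by apply: pHV; rewrite // (piK' iso hK) line2r.
have /vlineP[c e] := hyp_orth_line hK' xK yK x0 xy.
have c0 : c != 0 by apply: contraNneq y0 => c0; rewrite e c0 scale0r.
have : p y \in <[p x]>%VS.
  apply: cap_hyps; first exact: p0.
  move=> H hH pxH; rewrite -(piK' iso hH); apply: pH; rewrite ?(pi_hyp' iso) //.
  rewrite e memvZ //; apply: pHV => //; first exact: (pi_hyp' iso).
  by rewrite (piK' iso hH).
by move/vlineP => [a ea]; move: nz; rewrite ea !omE mulr0 eqxx.
Qed.

End Points.

(** * From points to semilinear similitudes *)

(** The fields are those that conjugation calls for: [ss_surj] makes conjugates linear, and
    [ss_inj], which combines injectivity of [sigma] with [lambda] being nonzero, allows the form to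
    be pulled back. *)
Record semisymplectic (s s' : V -> V) (sigma : F -> F) (lambda : F) : Prop := Semisymplectic {
  ssK : cancel s s';
  ssVK : cancel s' s;
  ssD : {morph s : x y / x + y};
  ssZ : forall a x, s (a *: x) = sigma a *: s x;
  ss_surj : forall c, exists a, sigma a = c;
  ss_inj : injective (fun c => lambda * sigma c);
  ss_form : forall x y, '[s x, s y] = lambda * sigma '[x, y] }.

Section Semilinear.
Hypothesis dim3 : (3 <= \dim {:V})%N.
Variables p p' : V -> V.
Hypothesis p_neq0 : forall x, x != 0 -> p x != 0.
Hypothesis p'_neq0 : forall x, x != 0 -> p' x != 0.
Hypothesis p'K : forall x, x != 0 -> p (p' x) \in <[x]>%VS.
Hypothesis p_orth : forall x y, x != 0 -> y != 0 -> ('[p x, p y] == 0) = ('[x, y] == 0).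

Lemma line_eq x y : x != 0 -> x \in <[y]>%VS -> <[x]>%VS = <[y]>%VS.
Proof.
move=> x0 xy; apply/eqP; rewrite eqEdim -memvE xy !dim_vline x0.
by case: (y == 0).
Qed.

Lemma span2 x y : <<[:: x; y]>>%VS = line2 x y.
Proof. by rewrite span_cons span_seq1. Qed.

Lemma free2 x y : free [:: x; y] = (x \notin <[y]>%VS) && (y != 0).
Proof. by rewrite free_cons span_seq1 seq1_free. Qed.

Lemma free3 x y z : free [:: x; y; z] = (x \notin line2 y z) && free [:: y; z].
Proof. by rewrite free_cons span2. Qed.

Lemma line_neq0 x y : <[x]>%VS = <[y]>%VS -> y != 0 -> x != 0.
Proof. by move/(congr1 (fun U : {vspace V} => \dim U)); rewrite !dim_vline; case: eqP;
  case: eqP. Qed.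

(** Both planes are double perpendiculars, so membership is a matter of orthogonality; each nonzero
    [w] is a multiple of [p (p' w)], so it suffices to test against values of [p]. *)
Lemma p_line2 x y z : x != 0 -> y != 0 -> z != 0 ->
  (p z \in line2 (p x) (p y)) = (z \in line2 x y).
Proof.
move=> x0 y0 z0; rewrite -[line2 x y]perpK -[line2 (p x) _]perpK.
apply/mem_orthovP/mem_orthovP => H w; rewrite perp_line2 => /andP[wx wy].
  case: (eqVneq w 0) => [->|w0]; first by rewrite om0r.
  apply/eqP; rewrite -p_orth //; apply/eqP/H.
  by rewrite perp_line2 !p_orth // wx wy.
case: (eqVneq w 0) => [->|w0]; first by rewrite om0r.
have v0 := p'_neq0 w0; have e := line_eq (p_neq0 v0) (p'K w0).
have /vlineP[c ew] : w \in <[p (p' w)]>%VS by rewrite e memv_line.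
have c0 : c != 0 by apply: contraNneq w0 => c0; rewrite ew c0 scale0r.
move: wx wy; rewrite ew !omE !mulf_eq0 (negbTE c0) /= !p_orth // => wx wy.
have /eqP : '[z, p' w] = 0 by apply: H; rewrite perp_line2 wx wy.
by rewrite -p_orth // => /eqP ->; rewrite mulr0.
Qed.

Lemma line2xx x : line2 x x = <[x]>%VS.
Proof. exact: addvv. Qed.

Lemma p_line x z : x != 0 -> z != 0 -> (p z \in <[p x]>%VS) = (z \in <[x]>%VS).
Proof. by move=> x0 z0; rewrite -!line2xx p_line2. Qed.

(* v' spans the image of the point <v>.  Lifts x' and y' of independent x and y are
   compatible when x' - y' lifts x - y; with differences instead of sums this is an
   equivalence relation (see lift_trans). *)
Definition lift v v' := (<[v']> = <[p v]>)%VS.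

Lemma lift_neq0 v v' : v != 0 -> lift v v' -> v' != 0.
Proof. by move=> v0 /line_neq0; apply; apply: p_neq0. Qed.

Lemma free_neq0 (X : seq V) x : free X -> x \in X -> x != 0.
Proof. by move=> fX xX; apply: (free_not0 fX). Qed.

Lemma p_free2 x y : free [:: x; y] -> free [:: p x; p y].
Proof.
move=> f; have x0 := free_neq0 (x := x) f; have y0 := free_neq0 (x := y) f.
move: x0 y0 f; rewrite !inE !eqxx orbT => /(_ isT) x0 /(_ isT) y0.
by rewrite !free2 p_line // p_neq0 // y0.
Qed.

Lemma p_free3 x y z : free [:: x; y; z] -> free [:: p x; p y; p z].
Proof.
move=> f; have x0 := free_neq0 (x := x) f; have y0 := free_neq0 (x := y) f.
have z0 := free_neq0 (x := z) f.
move: x0 y0 z0 f; rewrite !inE !eqxx !orbT => /(_ isT) x0 /(_ isT) y0 /(_ isT) z0.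
by rewrite !free3 p_line2 // => /andP[-> /p_free2 ->].
Qed.

Lemma span_eq_free (X Y : seq V) : size X = size Y -> <<X>>%VS = <<Y>>%VS -> free X = free Y.
Proof. by move=> eXY e; rewrite /free e eXY. Qed.

Lemma lift_free2 x y x' y' : free [:: x; y] -> lift x x' -> lift y y' -> free [:: x'; y'].
Proof.
move=> /p_free2 f ex ey; rewrite (@span_eq_free _ [:: p x; p y]) //.
by rewrite !span_cons span_nil ex ey.
Qed.

Lemma lift_free3 x y z x' y' z' : free [:: x; y; z] -> lift x x' -> lift y y' -> lift z z' ->
  free [:: x'; y'; z'].
Proof.
move=> /p_free3 f ex ey ez; rewrite (@span_eq_free _ [:: p x; p y; p z]) //.
by rewrite !span_cons span_nil ex ey ez.
Qed.

Lemma lift_line2 x y z x' y' z' : x != 0 -> y != 0 -> z != 0 -> lift x x' -> lift y y' ->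
  lift z z' ->
  z \in line2 x y -> z' \in line2 x' y'.
Proof.
move=> x0 y0 z0 ex ey ez; rewrite -p_line2 // /line2 ex ey => h.
have : z' \in <[p z]>%VS by rewrite -ez memv_line.
by case/vlineP => c ->; rewrite memvZ.
Qed.

Lemma liftI v v' : v' != 0 -> v' \in <[p v]>%VS -> lift v v'.
Proof. exact: line_eq. Qed.

Lemma liftIr v v' : v != 0 -> p v \in <[v']>%VS -> lift v v'.
Proof. by move=> v0 h; apply/esym/line_eq; rewrite ?p_neq0. Qed.

Lemma lift_refl v : lift v (p v).
Proof. by []. Qed.

Lemma liftN v v' : v != 0 -> lift v v' -> lift (- v) (- v').
Proof.
move=> v0 e; have n0 : - v != 0 by rewrite oppr_eq0.
apply: liftI; first by rewrite oppr_eq0 (lift_neq0 v0 e).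
have -> : <[p (- v)]>%VS = <[p v]>%VS.
  by apply: line_eq; rewrite ?p_neq0 // p_line // memvN memv_line.
by rewrite memvN -e memv_line.
Qed.

Lemma free2_coef x y a b a' b' : free [:: x; y] -> a *: x + b *: y = a' *: x + b' *: y ->
  a = a' /\ b = b'.
Proof.
rewrite free2 => /andP[xy y0] /eqP; rewrite -subr_eq0 opprD addrACA -!scalerBl => /eqP e.
have a0 : a - a' = 0.
  apply/eqP/negPn/negP => a0; case/negP: xy.
  rewrite -[x]scale1r -(mulVf a0) -scalerA memvZ //.
  by move/eqP: e; rewrite addr_eq0 => /eqP ->; rewrite memvN memvZ ?memv_line.
move/eqP: e; rewrite a0 scale0r add0r scaler_eq0 (negbTE y0) orbF !subr_eq0 => /eqP.
by move/eqP: a0; rewrite subr_eq0 => /eqP.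
Qed.

Lemma free3_coef x y z a b c a' b' c' : free [:: x; y; z] ->
  a *: x + b *: y + c *: z = a' *: x + b' *: y + c' *: z -> [/\ a = a', b = b' & c = c'].
Proof.
rewrite free3 => /andP[xyz fyz] e.
have aa : a = a'.
  apply/eqP; rewrite -subr_eq0; apply/negPn/negP => a0; case/negP: xyz.
  rewrite -[x]scale1r -(mulVf a0) -scalerA memvZ //.
  move/eqP: e; rewrite -subr_eq0 !opprD addrACA [X in X + _]addrACA -!scalerBl -addrA addr_eq0.
  by move/eqP ->; rewrite memvN memvD ?memvZ ?line2l ?line2r.
by move: e; rewrite aa -!addrA => /addrI /(free2_coef fyz)[-> ->].
Qed.

Lemma free2C x y : free [:: x; y] = free [:: y; x].
Proof. by rewrite (perm_free (permEl (perm_catC [:: x] [:: y]))). Qed.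

Lemma free3_rot x y z : free [:: x; y; z] = free [:: y; z; x].
Proof. by rewrite (perm_free (permEl (perm_catC [:: x] [:: y; z]))). Qed.

Lemma free3_swap x y z : free [:: x; y; z] = free [:: y; x; z].
Proof. by rewrite (perm_free (permEl (perm_catCA [:: x] [:: y] [:: z]))). Qed.

Lemma free2_neq0 x y : free [:: x; y] -> [/\ x != 0, y != 0 & x - y != 0].
Proof.
move=> f; have := f; rewrite free2C free2 => /andP[_ x0].
move: f; rewrite free2 => /andP[xy y0]; split=> //.
by rewrite subr_eq0; apply: contraNneq xy => ->; apply: memv_line.
Qed.

Lemma free3_sub x y z : free [:: x; y; z] ->
  [/\ free [:: x; y], free [:: x; z] & free [:: y; z]].
Proof.
move=> f; split.
- by move: f; rewrite 2!free3_rot free3 => /andP[].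
- by move: f; rewrite free3_swap free3 => /andP[].
- by move: f; rewrite free3 => /andP[].
Qed.

Lemma free3_add x y z : free [:: x; y; z] -> x + y != 0 /\ x + y - z != 0.
Proof.
move=> f; have n0 a b c : a != 0 -> a *: x + b *: y + c *: z != 0.
  move=> a0; apply: contra a0 => /eqP e.
  have [] := @free3_coef x y z a b c 0 0 0 f; first by rewrite e !scale0r !addr0.
  by move=> ->.
split; first by have := n0 1 1 0 (oner_neq0 _); rewrite !scale1r scale0r addr0.
by have := n0 1 1 (-1) (oner_neq0 _); rewrite !scale1r scaleN1r.
Qed.

Lemma lift_exists x x' y : free [:: x; y] -> lift x x' ->
  exists y', lift y y' /\ lift (x - y) (x' - y').
Proof.
move=> f ex; have [x0 y0 xy0] := free2_neq0 f.
have nxy : x \notin <[y]>%VS by move: f; rewrite free2 => /andP[].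
have nyx : y \notin <[x]>%VS by move: f; rewrite free2C free2 => /andP[].
have : p (x - y) \in line2 x' (p y).
  by apply: (lift_line2 x0 y0 xy0) => //; rewrite memvB ?line2l ?line2r.
case/line2P => a [b e].
have a0 : a != 0.
  apply: contra nxy => /eqP a0; rewrite -(subrK y x) memvD ?memv_line //.
  by rewrite -p_line // e a0 scale0r add0r memvZ ?memv_line.
have b0 : b != 0.
  apply: contra nyx => /eqP b0; rewrite -[y](subKr x) memvB ?memv_line //.
  by rewrite -p_line // -ex e b0 scale0r addr0 memvZ ?memv_line.
(* With this choice [p (x - y) = a *: x' + b *: p y] is [a] times [x' - y']. *)
exists (- (b / a) *: p y); split.
  apply: liftI; last by rewrite memvZ ?memv_line.
  by rewrite scaler_eq0 oppr_eq0 mulf_eq0 invr_eq0 !negb_or b0 a0 p_neq0.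
apply: liftIr => //; apply/vlineP; exists a.
by rewrite e scaleNr opprK scalerDr scalerA mulrC divfK.
Qed.

Lemma lift_uniq x x' y y1 y2 : free [:: x; y] -> lift x x' -> lift y y1 -> lift y y2 ->
  lift (x - y) (x' - y1) -> lift (x - y) (x' - y2) -> y1 = y2.
Proof.
move=> f ex e1 e2 d1 d2; have f2 := lift_free2 f ex e2.
have /vlineP[c ec] : x' - y1 \in <[x' - y2]>%VS by rewrite d2 -d1 memv_line.
have /vlineP[d ed] : y1 \in <[y2]>%VS by rewrite e2 -e1 memv_line.
have [|<- /oppr_inj e] := @free2_coef x' y2 1 (- d) c (- c) f2.
  by rewrite scale1r !scaleNr -ed ec scalerBr.
by rewrite ed e scale1r.
Qed.

(** As [y - z] is the difference of [x - z] and [x - y], the vector [p (y - z)] lies in the span of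
    [y'], [z'] and in that of [x' - y'], [x' - z']; the vanishing coefficient of [x'] makes it a
    multiple of [y' - z']. *)
Lemma lift_trans x y z x' y' z' : free [:: x; y; z] -> lift x x' -> lift y y' -> lift z z' ->
  lift (x - y) (x' - y') -> lift (x - z) (x' - z') -> lift (y - z) (y' - z').
Proof.
move=> f ex ey ez exy exz; have [fxy fxz fyz] := free3_sub f.
have [x0 y0 xy0] := free2_neq0 fxy; have [_ z0 xz0] := free2_neq0 fxz.
have [_ _ yz0] := free2_neq0 fyz.
have : p (y - z) \in line2 y' z'.
  by apply: (lift_line2 y0 z0 yz0) => //; rewrite memvB ?line2l ?line2r.
case/line2P => b [c e1].
have : p (y - z) \in line2 (x' - y') (x' - z').
  apply: (lift_line2 xy0 xz0 yz0) => //.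
  have -> : y - z = (x - z) - (x - y) by rewrite opprB [RHS]addrC addrA subrK.
  by rewrite memvB ?line2l ?line2r.
case/line2P => d [a e2].
have [|ea eb ec] := @free3_coef x' y' z' 0 b c (d + a) (- d) (- a) (lift_free3 f ex ey ez).
  rewrite scale0r add0r -e1 e2 !scalerBr scalerDl !scaleNr.
  by rewrite [LHS]addrACA addrA.
apply: liftIr => //; apply/vlineP; exists b; rewrite e1 scalerBr -scaleNr.
congr (_ + _ *: _); rewrite ec eb opprK; apply/eqP.
by rewrite eq_sym -addr_eq0 -ea.
Qed.

(** The point of [x + y - z] is where the lines through [x - z], [y] and through [x], [y - z] meet;
    then the point of [x + y] is where those through [x + y - z], [z] and through [x], [y] meet. *)
Lemma lift_add x y z x' y' z' : free [:: x; y; z] -> lift x x' -> lift y y' -> lift z z' ->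
  lift (x - z) (x' - z') -> lift (y - z) (y' - z') ->
  lift (x + y) (x' + y') /\ lift (x + y - z) (x' + y' - z').
Proof.
move=> f ex ey ez exz eyz; have [fxy fxz fyz] := free3_sub f.
have [x0 y0 _] := free2_neq0 fxy; have [_ z0 xz0] := free2_neq0 fxz.
have [_ _ yz0] := free2_neq0 fyz; have [s0 t0] := free3_add f.
have f' := lift_free3 f ex ey ez.
have et : lift (x + y - z) (x' + y' - z').
  have : p (x + y - z) \in line2 (x' - z') y'.
    apply: (lift_line2 xz0 y0 t0) => //.
    by rewrite addrAC memvD ?line2l ?line2r.
  case/line2P => a [b e1].
  have : p (x + y - z) \in line2 x' (y' - z').
    apply: (lift_line2 x0 yz0 t0) => //.
    by rewrite -addrA memvD ?line2l ?line2r.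
  case/line2P => c [d e2].
  have [|ea eb ec] := @free3_coef x' y' z' a b (- a) c d (- d) f'.
    by move: e2; rewrite e1 !scalerBr !scaleNr addrAC addrA.
  apply: liftIr => //; apply/vlineP; exists a.
  by rewrite e1 eb -(oppr_inj ec) !scalerBr scalerDr addrAC.
split=> //.
have : p (x + y) \in line2 (x' + y' - z') z'.
  apply: (lift_line2 t0 z0 s0) => //.
  by rewrite -[X in X \in _](subrK z) memvD ?line2l ?line2r.
case/line2P => a [b e1].
have : p (x + y) \in line2 x' y'.
  by apply: (lift_line2 x0 y0 s0) => //; rewrite memvD ?line2l ?line2r.
case/line2P => c [d e2].
have [|ea eb ec] := @free3_coef x' y' z' a a (b - a) c d 0 f'.
  by rewrite scale0r addr0 -e2 e1 scalerBr scalerDr scalerBl addrA addrAC.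
by apply: liftIr => //; apply/vlineP; exists a; rewrite e2 -ea -eb scalerDr.
Qed.

Lemma vec_out x y : exists z, z \notin line2 x y.
Proof.
have /subvPn[z _ nz] : ~~ (fullv <= line2 x y)%VS; last by exists z.
apply/negP => /dimvS; have [le _] := dimv_add_leqif <[x]> <[y]>.
move: le; rewrite !dim_vline -/(line2 x y); move: dim3.
by case: (x != 0); case: (y != 0); clear; lia.
Qed.

Lemma vec_out1 x : x != 0 -> exists z, free [:: x; z].
Proof.
by move=> x0; have [z] := vec_out x x; rewrite line2xx => h; exists z; rewrite free2C free2 h x0.
Qed.

Lemma vec_out2 x y : free [:: x; y] -> exists z, free [:: x; y; z].
Proof.
by move=> f; have [z h] := vec_out x y; exists z; rewrite 2!free3_rot free3 h f.
Qed.

Lemma line2_exchange a b x y : free [:: a; b] -> a \in line2 x y -> b \in line2 x y ->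
  line2 a b = line2 x y.
Proof.
rewrite free2 => /andP[ab b0] ha hb; apply/eqP; rewrite eqEdim line2S ha hb (dim_line2 ab b0) /=.
have [le _] := dimv_add_leqif <[x]> <[y]>. apply: (leq_trans le); rewrite !dim_vline.
by case: (x != 0); case: (y != 0).
Qed.

Lemma notin_line1 x y : free [:: x; y] = (y \notin <[x]>%VS) && (x != 0).
Proof. by rewrite free2C free2. Qed.

(* A fixed lift of x0 determines lifts of the vectors outside <x0>; those of the
   multiples of x0 are determined by the lift of some y0 outside <x0>. *)
Lemma lift_section : exists s : V -> V, (forall x, x != 0 -> lift x (s x)) /\
  forall x y, free [:: x; y] -> lift (x - y) (s x - s y).
Proof.
have [x0 [y0 f0]] : exists x0 y0, free [:: x0; y0].
  have [z] := vec_out 0 0; rewrite line2xx => nz.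
  have z0 : z != 0 by apply: contraNneq nz => ->; rewrite mem0v.
  by have [y fy] := vec_out1 z0; exists z, y.
have [x00 _ _] := free2_neq0 f0.
have ex z : exists t : V -> V -> V, forall z' y, free [:: z; y] -> lift z z' ->
    lift y (t z' y) /\ lift (z - y) (z' - t z' y).
  have /choice[t tP] : forall zy : V * V, exists t, free [:: z; zy.2] -> lift z zy.1 ->
      lift zy.2 t /\ lift (z - zy.2) (zy.1 - t).
    move=> [z' y] /=; case: (pselect (free [:: z; y] /\ lift z z')) => [[f e]|n].
      by have [y' H] := lift_exists f e; exists y'.
    by exists 0 => f e; case: n.
  by exists (fun z' y => t (z', y)) => z' y f e; apply: (tP (z', y)).
have [t0 t0P] := ex x0; have [t1 t1P] := ex y0.
pose y0' := t0 (p x0) y0.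
pose s x := if x \in <[x0]>%VS then t1 y0' x else t0 (p x0) x.
have [my0 d00] := t0P (p x0) y0 f0 (lift_refl x0).
have f1 x : x \in <[x0]>%VS -> x != 0 -> free [:: y0; x].
  move=> xl n0; rewrite free2 n0 andbT (line_eq n0 xl).
  by move: f0; rewrite notin_line1 => /andP[].
have sP x : x != 0 -> lift x (s x).
  move=> n0; rewrite /s; case: ifP => xl; first by have [] := t1P y0' x (f1 x xl n0) my0.
  by have [] := t0P (p x0) x _ (lift_refl x0); rewrite // notin_line1 xl.
exists s; split=> //.
pose D x y := lift (x - y) (s x - s y).
have sy0 : s y0 = y0'.
  by rewrite /s ifF //; move: f0; rewrite notin_line1 => /andP[/negbTE].
have D0 x : x \notin <[x0]>%VS -> lift (x0 - x) (p x0 - s x).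
  by move=> xl; rewrite /s (negbTE xl); have [] := t0P (p x0) x _ (lift_refl x0);
    rewrite // notin_line1 xl.
have D1 x : x \in <[x0]>%VS -> x != 0 -> D y0 x.
  by move=> xl n0; rewrite /D sy0 /s xl; have [] := t1P y0' x (f1 x xl n0) my0.
have DC x y : free [:: x; y] -> D x y -> D y x.
  by move=> /free2_neq0[_ _ n0] /(liftN n0); rewrite !opprB.
have DT x y z : free [:: x; y; z] -> D x y -> D x z -> D y z.
  move=> f; have [fxy fxz _] := free3_sub f.
  have [n1 n2 _] := free2_neq0 fxy; have [_ n3 _] := free2_neq0 fxz.
  by apply: (lift_trans f); apply: sP.
have Di x y : free [:: x0; x; y] -> D x y.
  move=> f; have [fx fy fxy] := free3_sub f; have [n1 n2 _] := free2_neq0 fxy.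
  apply: (lift_trans f (lift_refl x0)); try exact: sP.
  - by apply: D0; move: fx; rewrite notin_line1 => /andP[].
  - by apply: D0; move: fy; rewrite notin_line1 => /andP[].
(* If [x0] lies in the plane of [x] and [y], compatibility is carried over through a vector [z]
   outside that plane. *)
have Dii x y : free [:: x; y] -> x \notin <[x0]>%VS -> y \notin <[x0]>%VS -> D x y.
  move=> f nx ny; have [z fz] := vec_out2 f.
  have [fxy fxz fyz] := free3_sub fz.
  case: (boolP (x0 \in line2 x y)) => h; last by apply: Di; rewrite free3 h f.
  have nz : z \notin line2 x y by move: fz; rewrite 2!free3_rot free3 => /andP[].
  have key w : w \in line2 x y -> w \notin <[x0]>%VS -> D w z.
    move=> wl wn; have fw : free [:: x0; w] by rewrite notin_line1 wn.
    by apply: Di; rewrite 2!free3_rot free3 fw andbT (line2_exchange fw h wl).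
  apply: (DT z); first by rewrite 2!free3_rot in fz.
  - by apply: DC => //; apply: key; rewrite ?line2l.
  - by apply: DC => //; apply: key; rewrite ?line2r.
(* A multiple [x] of [x0] is first compared through [y0] with vectors outside the plane of [x0] and
   [y0], and through one of these with vectors inside it. *)
have Diii x y : free [:: x; y] -> x \in <[x0]>%VS -> D x y.
  move=> f xl; have [n1 n2 _] := free2_neq0 f; have ex0 := line_eq n1 xl.
  have yl : y \notin <[x0]>%VS by move: f; rewrite notin_line1 ex0 => /andP[].
  have fxy0 := f1 x xl n1.
  have key z : z \notin line2 x0 y0 -> D x z.
    move=> nz; have fz : free [:: x0; y0; z] by rewrite 2!free3_rot free3 nz.
    have fz' : free [:: y0; x; z].
      by rewrite free3_swap 2!free3_rot free3 [free _]free2C fxy0 /line2 ex0 nz.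
    by apply: (DT y0) => //; [apply: D1 | apply: Di].
  case: (boolP (y \in line2 x0 y0)) => h; last exact: key.
  have [z nz] := vec_out x0 y0.
  have fy : free [:: x0; y] by rewrite notin_line1 yl.
  have eyl := line2_exchange fy (line2l x0 y0) h.
  have fzy : free [:: x0; y; z] by rewrite 2!free3_rot free3 fy eyl nz.
  have fzxy : free [:: z; x; y] by rewrite free3 f /line2 ex0 -/(line2 x0 y) eyl nz.
  have [fzx' fzy' _] := free3_sub fzxy.
  apply: (DT z) => //; first by apply: DC; rewrite 1?free2C //; apply: key.
  by apply: DC; rewrite 1?free2C //; apply: Di.
move=> x y f.
case: (boolP (x \in <[x0]>%VS)) => xl; first exact: Diii.
case: (boolP (y \in <[x0]>%VS)) => yl; last exact: Dii.
by apply: (DC y x); rewrite 1?free2C //; apply: Diii; rewrite 1?free2C.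
Qed.

(** * Additivity, scalars and form of the lifted map *)

Section SemilinearMap.
Variable s : V -> V.
Hypothesis s0 : s 0 = 0.
Hypothesis s_lift : forall x, x != 0 -> lift x (s x).
Hypothesis s_sub : forall x y, free [:: x; y] -> lift (x - y) (s x - s y).

Lemma semilin_neq0 x : x != 0 -> s x != 0.
Proof. by move=> x0; apply: (lift_neq0 x0); apply: s_lift. Qed.

(** Both [s (x + y)] and [s x + s y] lift [x + y] compatibly with the lift of a third independent
    vector [z], and such a lift is unique. *)
Lemma semilin_add_free x y : free [:: x; y] -> s (x + y) = s x + s y.
Proof.
move=> fxy; have [z f] := vec_out2 fxy; have [_ fxz fyz] := free3_sub f.
have [x0 y0 _] := free2_neq0 fxy; have [_ z0 _] := free2_neq0 fxz.
have [xy0 _] := free3_add f.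
have [m1 m2] := lift_add f (s_lift x0) (s_lift y0) (s_lift z0) (s_sub fxz) (s_sub fyz).
have fz : free [:: z; x + y].
  rewrite notin_line1 z0 andbT; apply/negP => /vlineP[c e].
  have := f; rewrite free3 => /andP[/negP H _]; apply: H; apply/line2P.
  by exists (-1), c; rewrite scaleN1r addrC -e addrK.
have n0 : z - (x + y) != 0 by have [] := free2_neq0 fz.
apply: (lift_uniq fz (s_lift z0) (s_lift xy0) m1); first exact: s_sub.
have n0' : x + y - z != 0 by rewrite -oppr_eq0 opprB.
by have := liftN n0' m2; rewrite !opprB.
Qed.

Lemma free2_mix x z : free [:: x; z] -> forall y, y \in <[x]>%VS -> free [:: x;
  y + z] /\ (y != 0 -> free [:: y; z]).
Proof.
move=> f y yx; split.
  move: f; rewrite !notin_line1 => /andP[zx ->]; rewrite andbT.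
  by apply: contra zx => h; rewrite -(addKr y z) addrC memvB.
by move=> y0; move: f; rewrite !notin_line1 (line_eq y0 yx) y0 => /andP[->].
Qed.

(** For dependent [x] and [y], a vector [z] independent of [x] is added and [s (x + y + z)] is
    expanded in two ways. *)
Lemma semilin_add x y : s (x + y) = s x + s y.
Proof.
case: (eqVneq x 0) => [->|x0]; first by rewrite s0 !add0r.
case: (eqVneq y 0) => [->|y0]; first by rewrite s0 !addr0.
case: (boolP (y \in <[x]>%VS)) => yx; last by apply: semilin_add_free; rewrite notin_line1 yx.
have [z fz] := vec_out1 x0; have [fxyz /(_ y0) fyz] := free2_mix fz yx.
have e : s x + s (y + z) = s x + s y + s z by rewrite (semilin_add_free fyz) addrA.
rewrite -(semilin_add_free fxyz) addrA in e.
case: (eqVneq (x + y) 0) => [xy0|xy0].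
  move: e; rewrite xy0 add0r s0 => e.
  by apply: (addIr (s z)); rewrite add0r -e.
have fxy : free [:: x + y; z].
  by have [_] := free2_mix fz (memvD (memv_line x) yx); apply.
by move: e; rewrite (semilin_add_free fxy) => /addIr.
Qed.

Lemma semilin_scale_ex a x : exists c, s (a *: x) = c *: s x.
Proof.
case: (eqVneq (a *: x) 0) => [->|ax0]; first by exists 0; rewrite s0 scale0r.
have x0 : x != 0 by apply: contraNneq ax0 => ->; rewrite scaler0.
apply/vlineP; rewrite (s_lift x0).
have -> : <[p x]>%VS = <[p (a *: x)]>%VS.
  by apply/esym/line_eq; rewrite ?p_neq0 // p_line // memvZ ?memv_line.
by rewrite -(s_lift ax0) memv_line.
Qed.

Lemma semilin_free2 x y : free [:: x; y] -> free [:: s x; s y].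
Proof.
by move=> f; have [x0 y0 _] := free2_neq0 f; apply: (lift_free2 f); apply: s_lift.
Qed.

Lemma semilin_scale_free a x y c d : free [:: x; y] ->
  s (a *: x) = c *: s x -> s (a *: y) = d *: s y -> c = d.
Proof.
move=> f ec ed; have [e ee] := semilin_scale_ex a (x + y).
have [|-> ->] := @free2_coef (s x) (s y) c d e e (semilin_free2 f) => //.
by rewrite -ec -ed -semilin_add -scalerDr ee semilin_add scalerDr.
Qed.

Lemma semilin_scale : exists sigma : F -> F, forall a x, s (a *: x) = sigma a *: s x.
Proof.
have [z nz] := vec_out 0 0; rewrite line2xx in nz.
have z0 : z != 0 by apply: contraNneq nz => ->; rewrite mem0v.
have /choice[sg sgP] := fun a => semilin_scale_ex a z.
exists sg => a x; case: (eqVneq x 0) => [->|x0]; first by rewrite scaler0 s0 scaler0.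
have [c ec] := semilin_scale_ex a x; rewrite ec; congr (_ *: _).
case: (boolP (x \in <[z]>%VS)) => xz; last first.
  by apply: (@semilin_scale_free a x z) => //; rewrite free2 xz.
have [y fy] := vec_out1 x0; have [d ed] := semilin_scale_ex a y.
rewrite (semilin_scale_free fy ec ed); apply: (@semilin_scale_free a y z) => //.
by rewrite free2C; move: fy; rewrite !notin_line1 (line_eq x0 xz) z0 => /andP[->].
Qed.

Variable sigma : F -> F.
Hypothesis sE : forall a x, s (a *: x) = sigma a *: s x.

Lemma ex_neq0 : exists z : V, z != 0.
Proof.
have [z nz] := vec_out 0 0; rewrite line2xx in nz.
by exists z; apply: contraNneq nz => ->; rewrite mem0v.
Qed.

Lemma sigma_eq x a b : x != 0 -> a *: s x = b *: s x -> a = b.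
Proof.
move=> x0 /eqP; rewrite -subr_eq0 -scalerBl scaler_eq0 (negbTE (semilin_neq0 x0)) orbF.
by rewrite subr_eq0 => /eqP.
Qed.

Lemma sigma_mul a b : sigma (a * b) = sigma a * sigma b.
Proof.
have [z z0] := ex_neq0; apply: (sigma_eq z0).
by rewrite -sE -!scalerA !sE.
Qed.

Lemma sigma1 : sigma 1 = 1.
Proof. by have [z z0] := ex_neq0; apply: (sigma_eq z0); rewrite -sE !scale1r. Qed.

Lemma sigma_neq0 a : a != 0 -> sigma a != 0.
Proof.
move=> a0; apply/eqP => e; have := sigma_mul a a^-1.
by rewrite divff // sigma1 e mul0r => /eqP; rewrite oner_eq0.
Qed.

Lemma semilin_opp x : s (- x) = - s x.
Proof. by apply/eqP; rewrite -addr_eq0 -semilin_add addNr s0. Qed.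

Lemma semilin_inj : injective s.
Proof.
move=> x y e; apply/eqP; rewrite -subr_eq0; apply/negPn/negP => /semilin_neq0.
by rewrite semilin_add semilin_opp e subrr eqxx.
Qed.

Lemma p'_image x : x != 0 -> exists2 c, c != 0 & s (p' x) = c *: x.
Proof.
move=> x0; have w0 := p'_neq0 x0.
have : s (p' x) \in <[x]>%VS.
  by rewrite -(line_eq (p_neq0 w0) (p'K x0)) -(s_lift w0) memv_line.
case/vlineP => c e; exists c => //.
by apply: contraTneq (semilin_neq0 w0) => c0; rewrite e c0 scale0r eqxx.
Qed.

(** Up to a scalar, [s x + c *: s y] is the image of some [a *: x + b *: y]; comparing coefficients
    gives [c = sigma (b / a)]. *)
Lemma sigma_surj c : exists a, sigma a = c.
Proof.
case: (eqVneq c 0) => [->|c0].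
  exists 0; have [z z0] := ex_neq0; apply: (sigma_eq z0).
  by rewrite -sE !scale0r s0.
have [x x0] := ex_neq0; have [y f] := vec_out1 x0.
have [_ y0 _] := free2_neq0 f; have f' := semilin_free2 f.
set v := s x + c *: s y.
have v0 : v != 0.
  apply/eqP => e; have [|e1 _] := @free2_coef _ _ 1 c 0 0 f'.
    by rewrite scale1r -/v e !scale0r addr0.
  by move/eqP: e1; rewrite oner_eq0.
have w0 := p'_neq0 v0; have [d d0 ed] := p'_image v0.
have : p' v \in line2 x y.
  rewrite -p_line2 //; have /vlineP[e ->] := p'K v0; rewrite memvZ //.
  by rewrite /line2 -(s_lift x0) -(s_lift y0) memvD ?line2l ?memvZ ?line2r.
case/line2P => a [b ew].
have [|ea eb] := @free2_coef (s x) (s y) (sigma a) (sigma b) d (d * c) f'.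
  by rewrite -!sE -semilin_add -ew ed /v scalerDr scalerA.
have a0 : a != 0.
  apply: contraNneq d0 => a0; rewrite -ea a0; apply/eqP; apply: (sigma_eq x0).
  by rewrite -sE !scale0r s0.
exists (b / a); apply: (mulIf d0).
by rewrite -{1}ea -sigma_mul divfK // eb mulrC.
Qed.

Lemma semilin_surj y : exists x, s x = y.
Proof.
case: (eqVneq y 0) => [->|y0]; first by exists 0.
have [c c0 e] := p'_image y0; have [a ea] := sigma_surj c^-1.
by exists (a *: p' y); rewrite sE ea e scalerA mulVf // scale1r.
Qed.

Lemma semilin_orth x y : ('[s x, s y] == 0) = ('[x, y] == 0).
Proof.
case: (eqVneq x 0) => [->|x0]; first by rewrite s0 !om0l.
case: (eqVneq y 0) => [->|y0]; first by rewrite s0 !om0r.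
rewrite -(p_orth x0 y0).
have /vlineP[c ec] : p x \in <[s x]>%VS by rewrite (s_lift x0) memv_line.
have /vlineP[d ed] : p y \in <[s y]>%VS by rewrite (s_lift y0) memv_line.
have c0 : c != 0 by apply: contraTneq (p_neq0 x0) => c0; rewrite ec c0 scale0r eqxx.
have d0 : d != 0 by apply: contraTneq (p_neq0 y0) => d0; rewrite ed d0 scale0r eqxx.
by rewrite ec ed !omE !mulf_eq0 (negbTE c0) (negbTE d0).
Qed.

(** For fixed [x], preservation of orthogonality makes the two functionals of [y] proportional, with
    a factor [l x]. Skew symmetry gives [l x = l y] for non-orthogonal [x], [y], and any two nonzero
    vectors have a common vector orthogonal to neither. *)
Lemma semilin_form : exists lambda, forall x y, '[s x, s y] = lambda * sigma '[x, y].
Proof.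
have row x : x != 0 -> exists l, forall y, '[s x, s y] = l * sigma '[x, y].
  move=> x0; have [y xy] := om_neq0 x0.
  exists ('[s x, s y] / sigma '[x, y]) => z.
  have sxy := sigma_neq0 xy.
  have /eqP : '[s x, s (z - ('[x, z] / '[x, y]) *: y)] == 0.
    by rewrite semilin_orth !omE divfK // subrr.
  rewrite semilin_add semilin_opp sE !omE => /eqP; rewrite subr_eq0 => /eqP ->.
  have -> : sigma ('[x, z]) = sigma ('[x, z] / '[x, y]) * sigma '[x, y].
    by rewrite -sigma_mul divfK.
  by field.
have /choice[l lP] : forall x, exists l, x != 0 -> forall y, '[s x, s y] = l * sigma '[x, y].
  move=> x; case: (eqVneq x 0) => [_|x0]; first by exists 0.
  by have [l H] := row x x0; exists l.
have sigmaN a : sigma (- a) = - sigma a.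
  have [z z0] := ex_neq0; apply: (sigma_eq z0).
  by rewrite -sE scaleNr semilin_opp sE scaleNr.
have lE x y : '[x, y] != 0 -> l x = l y.
  move=> xy; have x0 : x != 0 by apply: contraNneq xy => ->; rewrite om0l.
  have y0 : y != 0 by apply: contraNneq xy => ->; rewrite om0r.
  apply: (mulIf (sigma_neq0 xy)); rewrite -(lP x x0) omC (lP y y0) (omC x y).
  by rewrite sigmaN mulrN.
have lEE x y : x != 0 -> y != 0 -> l x = l y.
  move=> x0 y0; have [u xu] := om_neq0 x0; have [v yv] := om_neq0 y0.
  case: (eqVneq '[y, u] 0) => [yu|yu]; last by rewrite (lE x u xu) (lE y u yu).
  case: (eqVneq '[x, v] 0) => [xv|xv]; last by rewrite (lE x v xv) (lE y v yv).
  by rewrite (lE x (u + v)) ?(lE y (u + v)) // omDr ?yu ?xv ?add0r ?addr0.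
have [z z0] := ex_neq0; exists (l z) => x y.
case: (eqVneq x 0) => [->|x0]; last by rewrite (lEE z x z0 x0) lP.
rewrite s0 !om0l; have -> : sigma 0 = 0; last by rewrite mulr0.
by apply: (sigma_eq z0); rewrite -sE !scale0r s0.
Qed.

End SemilinearMap.

Theorem semilinear_exists : exists s s' sigma lambda, semisymplectic s s' sigma lambda /\
  forall x, x != 0 -> lift x (s x).
Proof.
(* [lift_section] leaves the value at 0 open; it is set here. *)
have [s1 [h1 h2]] := lift_section; pose s x := if x == 0 then 0 else s1 x.
have s0 : s 0 = 0 by rewrite /s eqxx.
have s_lift x : x != 0 -> lift x (s x) by move=> x0; rewrite /s (negbTE x0); apply: h1.
have s_sub x y : free [:: x; y] -> lift (x - y) (s x - s y).
  by move=> f; have [x0 y0 _] := free2_neq0 f; rewrite /s (negbTE x0) (negbTE y0); apply: h2.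
have [sg sE] := semilin_scale s0 s_lift s_sub.
have /choice[s' s'P] := semilin_surj s0 s_lift s_sub sE.
have [l lP] := semilin_form s0 s_lift s_sub sE.
have [z z0] := ex_neq0.
have l0 : l != 0.
  have [y zy] := om_neq0 (semilin_neq0 s_lift z0); have [x xE] := semilin_surj s0 s_lift s_sub sE y.
  by apply: contraNneq zy => l0; rewrite -xE lP l0 mul0r.
exists s, s', sg, l; split=> //; split=> //.
- by move=> x; apply: (semilin_inj s0 s_lift s_sub); rewrite s'P.
- exact: semilin_add.
- exact: sigma_surj sE.
- move=> a b /(mulfI l0) e; have : s (a *: z) = s (b *: z) by rewrite !sE e.
  move/(semilin_inj s0 s_lift s_sub)/eqP; rewrite -subr_eq0 -scalerBl scaler_eq0 (negbTE z0) orbF.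
  by rewrite subr_eq0 => /eqP.
Qed.
End Semilinear.

(** * Conjugation by a semilinear similitude *)

Section SemisymplecticTheory.
Variables (s s' : V -> V) (sigma : F -> F) (lambda : F).
Hypothesis ss : semisymplectic s s' sigma lambda.

Lemma ss0 : s 0 = 0.
Proof. by apply: (addrI (s 0)); rewrite -(ssD ss) !addr0. Qed.

Lemma ssN x : s (- x) = - s x.
Proof. by apply/eqP; rewrite -addr_eq0 -(ssD ss) addNr ss0. Qed.

Lemma ss_sum I (r : seq I) (A : pred I) (E : I -> V) :
  s (\sum_(i <- r | A i) E i) = \sum_(i <- r | A i) s (E i).
Proof. exact: (big_morph s (ssD ss) ss0). Qed.

Lemma ss_orth x y : ('[s x, s y] == 0) = ('[x, y] == 0).
Proof.
have e0 : lambda * sigma 0 = 0 by rewrite -(om0l 0) -(ss_form ss) ss0 om0l.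
apply/eqP/eqP => [|xy]; last by rewrite (ss_form ss) xy e0.
by rewrite (ss_form ss) -{1}e0 => /(ss_inj ss).
Qed.

Lemma linear_lfun (phi : V -> V) : linear phi -> exists u : 'End(V), u =1 phi.
Proof.
move=> phiL; pose phiM := GRing.isLinear.Build _ _ _ _ phi phiL.
pose phiL' : {linear V -> V} := HB.pack phi phiM.
by exists (linfun phiL') => x; rewrite lfunE.
Qed.

(** A scalar written as [sigma b] becomes [b] under [s'], and [s] restores it. *)
Lemma conj_linear (u : V -> V) : linear u -> linear (fun x => s (u (s' x))).
Proof.
move=> uL a x y /=; have [b <-] := ss_surj ss a.
have -> : s' (sigma b *: x + y) = b *: s' x + s' y.
  by apply: (can_inj (ssK ss)); rewrite (ssD ss) (ssZ ss) !(ssVK ss).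
by rewrite uL (ssD ss) (ssZ ss).
Qed.

Lemma conjV_linear (u : V -> V) : linear u -> linear (fun x => s' (u (s x))).
Proof.
move=> uL a x y /=; apply: (can_inj (ssK ss)).
by rewrite !(ssVK ss) !(ssD ss) !(ssZ ss) uL !(ssVK ss).
Qed.

Lemma sp_conj (u : Sp Omega) : exists v : Sp Omega, forall x, v x = s (u (s' x)).
Proof.
have uL : linear u by move=> a x y; rewrite linearP.
have [v vE] := linear_lfun (conj_linear uL).
have [[u' uK u'K] iu] := SpP u.
have pv : sp_pred Omega v.
  apply/asboolP; split.
    exists (fun x => s (u' (s' x))) => x; rewrite !vE !(ssK ss) ?uK ?u'K (ssVK ss) //.
  move=> x y; rewrite !vE (ss_form ss) iu -(ss_form ss) !(ssVK ss).
  by [].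
by exists (MkSp pv).
Qed.

Lemma sp_conjV (u : Sp Omega) : exists v : Sp Omega, forall x, v x = s' (u (s x)).
Proof.
have uL : linear u by move=> a x y; rewrite linearP.
have [v vE] := linear_lfun (conjV_linear uL).
have [[u' uK u'K] iu] := SpP u.
have pv : sp_pred Omega v.
  apply/asboolP; split.
    exists (fun x => s' (u' (s x))) => x; rewrite !vE !(ssVK ss) ?uK ?u'K (ssK ss) //.
  move=> x y; rewrite !vE; apply: (ss_inj ss).
  by rewrite -!(ss_form ss) !(ssVK ss) iu.
by exists (MkSp pv).
Qed.

Lemma sp_ext (u v : Sp Omega) : (forall x, u x = v x) -> u = v.
Proof. by move=> e; apply: val_inj; apply/lfunP. Qed.

Lemma conj_automorphism : exists g : {multiplicative Sp Omega -> Sp Omega},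
  bijective g /\ forall u x, g u x = s (u (s' x)).
Proof.
have /choice[g gE] := sp_conj; have /choice[g' g'E] := sp_conjV.
have gM : {morph g : x y / (x * y)%g}.
  move=> u v; apply: sp_ext => x; rewrite gE.
  by rewrite /= !comp_lfunE !gE (ssK ss).
pose gL : {multiplicative Sp Omega ->
  Sp Omega} := HB.pack g (monoid.isMultiplicative.Build _ _ g gM).
exists gL; split; last exact: gE.
exists g' => u; apply: sp_ext => x; first by rewrite g'E gE !(ssK ss).
by rewrite gE g'E !(ssVK ss).
Qed.

End SemisymplecticTheory.

(** * From hyperbolic planes back to subspaces of dimension 2k *)

Lemma gr_frame n k (hdim : \dim {:V} = (2 * n)%N) W : gr k W ->
  exists (P : 'I_n -> {vspace V}) (I : {set 'I_n}), [/\ frame P, #|I| = k & W = sumI P I].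
Proof.
move=> /andP[nW dW].
have [||||s [hs es Hs]] := @comm_family_hseq [:: W] fullv.
- by rewrite /nondeg addvC addvf.
- by move=> U; rewrite inE => /eqP->.
- by move=> U U'; rewrite !inE => /eqP-> /eqP-> x.
- by move=> U x _ _; rewrite memvf.
have sn : size s = n by move: (hseq_dim hs); rewrite es hdim => /eqP; rewrite eqn_pmul2l // => /eqP.
have fP := hseq_frame sn hs.
have eW := compat_sumI fP hdim nW (fun i => Hs _ W (mem_nth _ _) (mem_head _ _)).
eexists; eexists; split; [exact: fP | | apply: eW]; last by move=> i; rewrite sn.
move: dW; rewrite {1}eW; last by move=> i; rewrite sn.
by rewrite (dim_sumI fP) eqn_pmul2l // => /eqP.
Qed.

(** A bijection of the subspaces in [gr k] with its inverse, given as total functions whose values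
    elsewhere are arbitrary. *)
Definition gr_isotopy k (f f' : {vspace V} -> {vspace V}) :=
  [/\ forall W, gr k W -> gr k (f W), forall W, gr k W -> gr k (f' W),
      forall W, gr k W -> f' (f W) = W, forall W, gr k W -> f (f' W) = W &
      forall U W, gr k U -> gr k W -> comm U W <-> comm (f U) (f W)].

(** [s] maps each plane into its image, hence sums into sums. The converse uses the complementary
    sum: if [s x] lies in [f W], it is orthogonal to the images of all vectors of [perp W], so [x]
    is orthogonal to [perp W]. *)
Theorem gr_semisymplectic_lt n k f f' : (0 < k)%N -> (2 * k < n)%N -> (5 <= n - k)%N ->
  \dim {:V} = (2 * n)%N -> gr_isotopy k f f' ->
  exists s s' sigma lambda, semisymplectic s s' sigma lambda /\
    forall W x, gr k W -> (s x \in f W) = (x \in W).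
Proof.
move=> k0 kn nk hdim [f_gr f'_gr fK f'K f_comm].
have [h [h' [h_hyp hK h_orth h'_orth fE]]] := plane_bijection k0 kn nk hdim f_gr f'_gr fK f'K
  f_comm.
have iso : plane_iso h h'.
  by split=> // X hX; have [] := h_hyp X hX; have [] := hK X hX.
have d9 : (9 <= \dim {:V})%N by rewrite hdim; move: kn nk; clear; lia.
have [p [p' [p0 p'K p_orth pH _]]] := point_bijection d9 iso.
have d3 : (3 <= \dim {:V})%N by apply: leq_trans d9.
have p1 x : x != 0 -> p x != 0 by case/p0.
have p'1 x : x != 0 -> p' x != 0 by case/p0.
have [s [s' [sg [l [ss s_lift]]]]] := semilinear_exists d3 p1 p'1 p'K p_orth.
exists s, s', sg, l; split=> // W x /(gr_frame hdim)[P [I [fP cI ->]]].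
have sP (J : {set 'I_n}) y : y \in sumI P J -> s y \in sumI (h \o P) J.
  move=> /memv_sumP[u uP ->]; rewrite (ss_sum ss); apply: memv_sumr => i iJ /=.
  case: (eqVneq (u i) 0) => [->|u0]; first by rewrite (ss0 ss) mem0v.
  have := pH _ _ (fP.1 i) u0 (uP i iJ); rewrite memvE -(s_lift _ u0).
  by rewrite -memvE.
have fQ : frame (h \o P).
  by split=> [i|i j ij] /=; [apply: (h_hyp _ (fP.1 i)).1 | apply: h_orth; rewrite ?fP.2 //;
    apply: fP.1].
rewrite fE //; apply/idP/idP => [sx|]; last exact: sP.
rewrite -[sumI P I]perpK; apply/mem_orthovP => y; rewrite (perp_sumIE fP hdim) => yP.
apply/eqP; rewrite -(ss_orth ss); apply/eqP; apply: (perpxC sx).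
by rewrite (perp_sumIE fQ hdim) sP.
Qed.

Lemma gr_perp n k W : \dim {:V} = (2 * n)%N -> (k <= n)%N -> gr k W -> gr (n - k) (perp W).
Proof.
move=> hdim kn /andP[nW /eqP dW]; rewrite /gr nondeg_perp //=.
have := dim_perp nW; rewrite hdim dW mulnBr => <-.
by rewrite addKn.
Qed.

Lemma comm_perpE U W : nondeg U -> nondeg W -> comm U W <-> comm (perp U) (perp W).
Proof.
move=> nU nW; split; first exact: comm_perp.
by move=> /(comm_perp (nondeg_perp nU) (nondeg_perp nW)); rewrite !perpK.
Qed.

Theorem gr_semisymplectic n k f f' : (1 <= k <= n.-1)%N -> n <> (2 * k)%N ->
  (5 <= maxn k (n - k))%N -> \dim {:V} = (2 * n)%N -> gr_isotopy k f f' ->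
  exists s s' sigma lambda, semisymplectic s s' sigma lambda /\
    forall W x, gr k W -> (s x \in f W) = (x \in W).
Proof.
move=> /andP[k0 kn1] n2k hmax hdim iso.
case: (ltnP (2 * k) n) => [kn|nk].
  apply: (gr_semisymplectic_lt (n := n) (k := k) k0 kn _ hdim iso).
  by move: hmax kn; clear; lia.
have kn : (k <= n)%N by move: kn1; clear; lia.
have kk : (n - (n - k))%N = k by rewrite subKn.
have grp W : gr (n - k) W -> gr k (perp W).
  by move=> gW; rewrite -[k in gr k]kk; apply: gr_perp; rewrite ?leq_subr.
have grp' W : gr k W -> gr (n - k) (perp W) by apply: gr_perp.
have [f_gr f'_gr fK f'K f_comm] := iso.
have iso' : gr_isotopy (n - k) (fun W => perp (f (perp W))) (fun W => perp (f' (perp W))).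
  split=> [W gW|W gW|W gW|W gW|U W gU gW].
  - exact/grp'/f_gr/grp.
  - exact/grp'/f'_gr/grp.
  - by rewrite perpK fK ?perpK ?grp.
  - by rewrite perpK f'K ?perpK ?grp.
  have nd j X : gr j X -> nondeg X by case/andP.
  rewrite (comm_perpE (nd _ _ gU) (nd _ _ gW)) (f_comm _ _ (grp _ gU) (grp _ gW)).
  by rewrite (comm_perpE (nd _ _ (f_gr _ (grp _ gU))) (nd _ _ (f_gr _ (grp _ gW)))).
have [|||s [s' [sg [l [ss H]]]]] := gr_semisymplectic_lt _ _ _ hdim iso'.
- by move: k0 kn1; clear; lia.
- by move: nk n2k kn; clear; lia.
- by rewrite kk; move: hmax nk n2k; clear; lia.
exists s, s', sg, l; split=> // W x gW.
have HW y : (s y \in perp (f W)) = (y \in perp W).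
  by rewrite -(H _ y (grp' _ gW)) perpK.
apply/idP/idP => [sx|xW].
  rewrite -[W]perpK; apply/mem_orthovP => y yW; apply/eqP.
  by rewrite -(ss_orth ss); apply/eqP/(perpxC sx); rewrite HW.
rewrite -[f W]perpK; apply/mem_orthovP => y; rewrite -(ssVK ss y) HW => yW.
by apply/eqP; rewrite (ss_orth ss); apply/eqP/(perpxC xW).
Qed.

(** * Involutions and orthogonal projections *)

Section Involutions.

Lemma half_add (x : V) : 2%:R^-1 *: (x + x) = x.
Proof. by rewrite -mulr2n -scaler_nat scalerA mulVf // scale1r. Qed.

Lemma addvv_inj (x y : V) : x + x = y + y -> x = y.
Proof. by move=> e; rewrite -(half_add x) e half_add. Qed.

Lemma Splus_perp (u : Sp Omega) x : u x = - x -> x \in perp (Splus u).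
Proof.
move=> ux; apply/mem_orthovP => y; rewrite mem_Splus => /eqP uy.
have [_ iu] := SpP u; have := iu x y; rewrite ux uy omNl => /eqP.
rewrite eq_sym -addr_eq0 -mulr2n -mulr_natr mulf_eq0 (negbTE two_neq0) orbF.
by move/eqP.
Qed.

Lemma invol_split (u : Sp Omega) : (u * u = 1)%g -> forall x,
  2%:R^-1 *: (x + u x) \in Splus u /\ x - 2%:R^-1 *: (x + u x) \in perp (Splus u).
Proof.
move=> uu x; have uuE y : u (u y) = y.
  by have := congr1 (fun w : Sp Omega => w y) uu; rewrite /= comp_lfunE id_lfunE.
split.
  by rewrite mem_Splus linearZ linearD /= uuE addrC.
apply: Splus_perp; rewrite linearB linearZ linearD /= uuE opprB [u x + x]addrC.
apply/eqP; rewrite subr_eq addrAC -scalerDr eq_sym subr_eq.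
by rewrite half_add addrC.
Qed.

Lemma Splus_nondeg (u : Sp Omega) : (u * u = 1)%g -> nondeg (Splus u).
Proof.
move=> uu; apply: nondegI => x; have [h1 h2] := invol_split uu x.
by exists (2%:R^-1 *: (x + u x)).
Qed.

Lemma invol_pr (u : Sp Omega) x : (u * u = 1)%g -> u x = pr (Splus u) x + pr (Splus u) x - x.
Proof.
move=> uu; have [h1 h2] := invol_split uu x.
rewrite (pr_uniq (Splus_nondeg uu) h1 h2) -scalerDr half_add.
by rewrite addrAC subrr add0r.
Qed.

Lemma invol_ext (u v : Sp Omega) : (u * u = 1)%g -> (v * v = 1)%g -> Splus u = Splus v -> u = v.
Proof. by move=> uu vv e; apply: sp_ext => x; rewrite !invol_pr // e. Qed.

(** With [u = 2p - 1] and [v = 2q - 1], the product is [4pq - 2(p + q) + 1], in which only the first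
    term depends on the order; 4 is invertible. *)
Lemma invol_comm (u v : Sp Omega) : (u * u = 1)%g -> (v * v = 1)%g ->
  (u * v = v * u)%g <-> comm (Splus u) (Splus v).
Proof.
move=> uu vv; set U := Splus u; set W := Splus v.
have uvE (a b : Sp Omega) x : (a * a = 1)%g -> (b * b = 1)%g -> (a * b)%g x =
    (pr (Splus a) (pr (Splus b) x) *+ 4) - (pr (Splus a) x + pr (Splus b) x) *+ 2 + x.
  move=> aa bb; rewrite /= comp_lfunE (invol_pr _ aa) (invol_pr _ bb) prB prD.
  set y := pr _ (pr _ x); set z := pr (Splus a) x; set t := pr (Splus b) x.
  rewrite opprB [x - _]addrC addrA; congr (_ + _).
  by rewrite mulrnDl -!mulr2n mulrnBl -mulrnA [in RHS]opprD [RHS]addrA.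
split=> [e x|c].
  have := congr1 (fun w : Sp Omega => w x) e; rewrite !uvE // [pr W x + _]addrC.
  move=> /addIr/addIr; rewrite -/U -/W (mulrnA _ 2 2) (mulrnA _ 2 2) !mulr2n.
  by move=> /addvv_inj/addvv_inj.
by apply: sp_ext => x; rewrite !uvE // c [pr (Splus v) x + _]addrC.
Qed.

Definition reflection W : 'End(V) := (pr W + pr W - \1)%VF.

Lemma reflectionE W x : reflection W x = pr W x + pr W x - x.
Proof. by rewrite !add_lfunE opp_lfunE id_lfunE. Qed.

Lemma pr_reflection W x : nondeg W -> pr W (reflection W x) = pr W x.
Proof.
move=> nW; rewrite reflectionE prB prD (pr_id nW (pr_mem W x)).
by rewrite addrK.
Qed.

Lemma reflectionK W : nondeg W -> involutive (reflection W).
Proof.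
move=> nW x; rewrite [LHS]reflectionE pr_reflection // reflectionE opprB.
by rewrite addrC subrK.
Qed.

(** Reversing the components in [perp W] of both arguments leaves the form unchanged, as the mixed
    terms vanish. *)
Lemma reflection_sp W : nondeg W -> sp_pred Omega (reflection W).
Proof.
move=> nW; apply/asboolP; split; first by exists (reflection W); apply: reflectionK.
have E x : reflection W x = pr W x - (x - pr W x) by rewrite reflectionE opprB addrA.
have H (a b c d : V) : '[a, d] = 0 -> '[c, b] = 0 -> '[a - c, b - d] = '[a + c, b + d].
  by move=> ad cb; rewrite !omE ad cb !(oppr0, addr0, add0r, opprK).
move=> x y; rewrite !E H ?(perpxC (pr_mem W x) (pr_perp y nW)) //; last first.
  exact: perpx (pr_perp x nW) (pr_mem W y).
by rewrite [pr W x + _]addrC [pr W y + _]addrC !subrK.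
Qed.

Lemma invol_exists W : nondeg W -> exists u : Sp Omega, (u * u = 1)%g /\ Splus u = W.
Proof.
move=> nW; exists (MkSp (reflection_sp nW)); split.
  by apply: sp_ext => x; rewrite /= comp_lfunE id_lfunE reflectionK.
apply/vspaceP => x; rewrite mem_Splus /= reflectionE; apply/eqP/idP => [/eqP|xW].
  by rewrite subr_eq => /eqP/addvv_inj <-; apply: pr_mem.
by rewrite pr_id // addrK.
Qed.

Lemma Sminus_perp (u : Sp Omega) : (u * u = 1)%g -> Sminus u = perp (Splus u).
Proof.
move=> uu; apply/vspaceP => x; rewrite mem_Sminus; apply/eqP/idP => [|xW].
  exact: Splus_perp.
by rewrite invol_pr // (pr_0 (Splus_nondeg uu) xW) addr0 sub0r.
Qed.

(** S_- is the perpendicular of S_+, so its dimension is determined. *)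
Lemma pq_involutionE n k (u : Sp Omega) : \dim {:V} = (2 * n)%N -> (k <= n)%N ->
  pq_involution (2 * k) (2 * n - 2 * k) u = ((u * u)%g == 1%g) && gr k (Splus u).
Proof.
move=> hdim kn; rewrite /pq_involution /gr; case: eqP => //= uu.
rewrite Splus_nondeg //= Sminus_perp //; case: eqP => //= d.
have := dim_perp (Splus_nondeg uu); rewrite d hdim => <-.
by rewrite addKn eqxx.
Qed.

End Involutions.

End SymplecticGeometry.

(** * Transfer from involutions to subspaces *)

Lemma two_neq0_pchar (F : fieldType) : 2%N \notin [pchar F] -> 2%:R != 0 :> F.
Proof. by rewrite inE. Qed.

Lemma symplectic_nondeg (F : fieldType) (V : vectType F) (Omega : {skew_symmetric V}) :
  is_psymplectic Omega -> forall x, (forall y, Omega x y = 0) -> x = 0.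
Proof.
move=> [/eqP nd _ _] x H; apply/eqP; rewrite -memv0 -nd; apply/mem_orthovP => y _.
exact: H.
Qed.

Theorem corollary1 (F : fieldType) (hF : 2%N \notin [pchar F])
    (V : vectType F) (n : nat) (hdim : \dim {:V} = (2 * n)%N)
    (Omega : {skew_symmetric V}) (hOmega : is_psymplectic Omega)
    (k : nat) (hk : (1 <= k <= n.-1)%N)
    (hn2k : n <> (2 * k)%N) (hmax : (5 <= maxn k (n - k))%N)
    (f : symp_invol Omega n k -> symp_invol Omega n k)
    (fbij : bijective f) (fcomm : commutativity_preserving f) :
  exists g : {multiplicative Sp Omega -> Sp Omega},
    bijective g /\ forall u : symp_invol Omega n k, g (val u) = val (f u).
Proof.
have nd := symplectic_nondeg hOmega; have two0 := two_neq0_pchar hF.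
have kn : (k <= n)%N by move: hk; clear; lia.
have invE u := pq_involutionE nd two0 u hdim kn.
have uu (u : symp_invol Omega n k) : (val u * val u = 1)%g.
  by have := valP u; rewrite invE => /andP[/eqP].
pose S (u : symp_invol Omega n k) := Splus (val u).
have gS u : gr Omega k (S u) by have := valP u; rewrite invE => /andP[].
have Sinj : injective S by move=> u v /(invol_ext nd two0 (uu u) (uu v))/val_inj.
have Ssurj W : gr Omega k W -> exists u, S u = W.
  move=> gW; have [u [u1 uW]] := invol_exists nd two0 (proj1 (andP gW)).
  have pu : pq_involution (2 * k) (2 * n - 2 * k) u by rewrite invE u1 eqxx uW.
  by exists (exist _ u pu).
(* Involutions correspond to subspaces in [gr k] through [S]; maps are extended by zero to all
   subspaces. *)
have transport (h : symp_invol Omega n k -> symp_invol Omega n k) :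
    exists h0 : {vspace V} -> {vspace V}, forall u, h0 (S u) = S (h u).
  have H W : exists W', forall u, S u = W -> W' = S (h u).
    case: (pselect (exists u, S u = W)) => [[u <-]|nW]; last first.
      by exists 0%VS => u e; case: nW; exists u.
    by exists (S (h u)) => v /Sinj ->.
  have [h0 h0P] := choice H; exists h0 => u; exact: h0P.
have [f' fK f'K] := fbij.
have [f0 f0E] := transport f; have [f1 f1E] := transport f'.
have iso : gr_isotopy Omega k f0 f1.
  split=> [W /Ssurj[u <-]|W /Ssurj[u <-]|W /Ssurj[u <-]|W /Ssurj[u <-]|U W /Ssurj[u <-] /Ssurj[v
    <-]].
  - by rewrite f0E.
  - by rewrite f1E.
  - by rewrite f0E f1E fK.
  - by rewrite f1E f0E f'K.
  rewrite !f0E /S -!(invol_comm nd two0) //; exact: fcomm.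
have [s [s' [sigma [lambda [ss sW]]]]] := gr_semisymplectic nd two0 hk hn2k hmax hdim iso.
have [g [gbij gE]] := conj_automorphism ss.
exists g; split=> // u; apply: sp_ext => x; rewrite gE.
have nS v : nondeg Omega (S v) by have /andP[] := gS v.
(* [s] carries components in [S u] and its perpendicular to components in [S (f u)] and its
   perpendicular, hence one projection to the other. *)
have prE : pr Omega (S (f u)) x = s (pr Omega (S u) (s' x)).
  apply: (pr_uniq nd (nS (f u))); first by rewrite -f0E sW ?pr_mem.
  rewrite -{1}[x](ssVK ss) -(ssN ss) -(ssD ss); apply/mem_orthovP => z.
  rewrite -f0E -(ssVK ss z) sW // => zu; apply/eqP; rewrite (ss_orth ss); apply/eqP.
  exact: perpx (pr_perp nd (s' x) (nS u)) zu.
rewrite (invol_pr nd two0 _ (uu u)) (invol_pr nd two0 _ (uu (f u))).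
by rewrite -!/(S _) prE !(ssD ss) (ssN ss) (ssVK ss).
Qed.
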